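(* Let $\Phi$ be an $N$-function whose Matuszewska-Orlicz indices satisfy $1<\alpha_\Phi\le\beta_\Phi<\infty$. Let $0<\theta<2\min\{1/\beta_\Phi,1-1/\alpha_\Phi\}$ and let $\Phi_\theta:=\widetilde\Psi_\theta^{-1}$, where $\widetilde\Psi_\theta$ is the least concave majorant of the function $\Psi_\theta$ given by $\Psi_\theta(0):=0$, $\Psi_\theta(t):=\left(\Phi^{-1}(t)\,t^{-\theta/2}\right)^{1/(1-\theta)}$ for $t>0$. Then $M_{\Phi_\theta}\subset M_\Phi$.
   Context: An $N$-function is a continuous, increasing, convex function $\Phi:[0,\infty)\to[0,\infty)$ with $\Phi(t)=0$ iff $t=0$, $\lim_{t\to0^+}\Phi(t)/t=0$ and $\lim_{t\to\infty}\Phi(t)/t=\infty$. The Orlicz sequence space $\ell^\Phi(\mathbb{Z})$ consists of all $f=\{f_n\}:\mathbb{Z}\to\mathbb{C}$ with $\varrho_\Phi(f/\lambda):=\sum_{n\in\mathbb{Z}}\Phi(|f_n/\lambda|)<\infty$ for some $\lambda>0$, normed by $\|f\|_{\ell^\Phi(\mathbb{Z})}:=\inf\{\lambda>0:\varrho_\Phi(f/\lambda)\le1\}$. For $t>0$ let $M(t,\Phi):=\sup_{0<u<\infty}\Phi(tu)/\Phi(u)\in(0,\infty]$. The Matuszewska-Orlicz indices are $\alpha_\Phi:=\sup_{0<t<1}\frac{\ln M(t,\Phi)}{\ln t}$ and $\beta_\Phi:=\inf_{t>1}\frac{\ln M(t,\Phi)}{\ln t}$. For $\Psi:[0,\infty)\to[0,\infty)$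 with $\Psi(t)=0$ iff $t=0$, its least concave majorant $\widetilde\Psi$ is the pointwise infimum of all concave functions $F:[0,\infty)\to[0,\infty)$ with $F(t)=0$ iff $t=0$ and $\Psi\le F$ on $[0,\infty)$. The notation $\Phi^{-1}$, $\widetilde\Psi_\theta^{-1}$ means inverse functions on $[0,\infty)$. The condition on $\theta$ forces $\theta<1$, and under the stated hypotheses $\Phi_\theta$ is an $N$-function with $1<\alpha_{\Phi_\theta}\le\beta_{\Phi_\theta}<\infty$. $\mathcal{P}'$ is the space of $2\pi$-periodic distributions, $\{\widehat a_j\}_{j\in\mathbb{Z}}$ are the Fourier coefficients of $a\in\mathcal{P}'$ (for an integrable function, $\widehat a_j=\frac1{2\pi}\int_{-\pi}^{\pi}a(x)e^{-ijx}dx$), and $S_0(\mathbb{Z})$ is the set of finitely supported sequences. For $\varphi\in S_0(\mathbb{Z})$, $(a*\varphi)_j:=\sum_k\widehat a_{j-k}\varphi_k$. For an $N$-function $\Phi$, $M_\Phi$ is the set of all $a\in\mathcal{P}'$ such that $a*\varphi\in\ell^\Phi(\mathbb{Z})$ for all $\varphi\in S_0(\mathbb{Z})$ and $\|a\|_{M_\Phi}:=\sup\{\|a*\varphi\|_{\ell^\Phi(\mathbb{Z})}/\|\varphi\|_{\ell^\Phi(\mathbb{Z})}:\varphi\in S_0(\mathbb{Z}),\varphi\ne0\}<\infty$. *)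

(* Defs.v *)
From HB Require Import structures.
From mathcomp Require Import all_boot all_order all_algebra.
From mathcomp Require Import all_classical all_reals all_analysis.
From mathcomp Require Import complex ring.

Set Implicit Arguments.
Unset Strict Implicit.
Unset Printing Implicit Defensive.

Import Order.TTheory GRing.Theory Num.Theory.
Import numFieldNormedType.Exports.
Import ComplexField.Normc.

Local Open Scope ring_scope.
Local Open Scope classical_set_scope.
Local Open Scope complex_scope.

(* A function [0, oo) -> [0, oo) is represented by a function R -> R of which
   only the values on [0, oo) matter. *)
Definition halfline (R : realType) : set R := `[0, +oo[.
Arguments halfline {R}.

Section Nfunctions.
Variable R : realType.
Implicit Types Phi Psi F : R -> R.

Definition maps_halfline F := forall t, 0 <= t -> 0 <= F t.

Definition vanishes_only_at0 F := forall t, 0 <= t -> (F t = 0 <-> t = 0).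

Record is_Nfunction Phi : Prop := IsNfunction {
  Nfun_halfline : maps_halfline Phi;
  Nfun_continuous : {within halfline, continuous Phi};
  Nfun_increasing : {in halfline &, {homo Phi : s t / s < t}};
  Nfun_convex : convex_function halfline Phi;
  Nfun_eq0 : vanishes_only_at0 Phi;
  Nfun_slope0 : Phi t / t @[t --> 0^'+] --> (0 : R);
  Nfun_slopey : Phi t / t @[t --> +oo] --> +oo }.

Local Open Scope ereal_scope.

(* The function t |-> M(t, Phi); it may take the value +oo. *)
Definition dilation Phi (t : R) : \bar R :=
  ereal_sup [set (Phi (t * u) / Phi u)%R%:E | u in [set u : R | (0 < u)%R]].

(* The Matuszewska-Orlicz indices alpha_Phi and beta_Phi. *)
Definition MO_lower Phi : \bar R :=
  ereal_sup [set lne (dilation Phi t) * ((ln t)^-1)%:E | t in `]0%R, 1%R[].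

Definition MO_upper Phi : \bar R :=
  ereal_inf [set lne (dilation Phi t) * ((ln t)^-1)%:E | t in `]1%R, +oo[].

Local Close Scope ereal_scope.

Definition concave_function (D : set R) F :=
  convex_function D (fun t => - F t).

Definition concave_majorants Psi : set (R -> R) :=
  [set F | [/\ maps_halfline F, concave_function halfline F,
               vanishes_only_at0 F & forall t, 0 <= t -> Psi t <= F t]].

Definition least_concave_majorant Psi (t : R) : R :=
  inf [set F t | F in concave_majorants Psi].

(* The genuine inverse whenever F is a bijection of [0, oo) onto itself, as is
   the case for N-functions and for the concave majorants used below. *)
Definition inv_halfline F : R -> R := pinv halfline F.

Definition Psi_theta Phi (theta t : R) : R :=
  if t == 0 then 0
  else (inv_halfline Phi t * t `^ (- (theta / 2))) `^ (1 - theta)^-1.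

Definition Phi_theta Phi (theta : R) : R -> R :=
  inv_halfline (least_concave_majorant (Psi_theta Phi theta)).

End Nfunctions.

Section Orlicz.
Variable R : realType.
Implicit Types (Phi : R -> R) (f phi : int -> R[i]).

(* rho_Phi(f / lambda) *)
Definition modular Phi f (lambda : R) : \bar R :=
  (\esum_(n in [set: int]) (Phi (normc (f n / lambda%:C)))%:E)%E.

Definition orlicz Phi : set (int -> R[i]) :=
  [set f | exists2 lambda : R, 0 < lambda & (modular Phi f lambda < +oo)%E].

(* Meaningful only on [orlicz Phi]: off that space the infimum is over the
   empty set, hence 0. *)
Definition orlicz_norm Phi f : R :=
  inf [set lambda : R | 0 < lambda /\ (modular Phi f lambda <= 1)%E].

Definition finitely_supported : set (int -> R[i]) :=
  [set phi | finite_set [set k | phi k != 0]].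

End Orlicz.
Arguments finitely_supported {R}.

Section PeriodicDistributions.
Variable R : realType.

(* The nth derivative of a complex-valued function of a real variable, taken
   componentwise. *)
Definition nderive (n : nat) (f : R -> R[i]) (x : R) : R[i] :=
  (fun y => complex.Re (f y))^`(n) x +i* (fun y => complex.Im (f y))^`(n) x.

Definition is_smooth (f : R -> R[i]) := forall (n : nat) (x : R),
  derivable ((fun y => complex.Re (f y))^`(n)) x 1 /\
  derivable ((fun y => complex.Im (f y))^`(n)) x 1.

Definition smooth_periodic : {pred R -> R[i]} :=
  mem [set f | is_smooth f /\ periodic f (pi *+ 2)].

Lemma smooth_linear (c : R[i]) (f g : R -> R[i]) : is_smooth f -> is_smooth g ->
  is_smooth (c *: f + g).
Proof.
move=> sf sg.
have D (a b : R) (u v w : R -> R) :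
    (forall n (x : R), derivable (derive1n n u) x 1) ->
    (forall n (x : R), derivable (derive1n n v) x 1) ->
    (forall n (x : R), derivable (derive1n n w) x 1) ->
    forall n (x : R), derivable ((fun y => a * u y + b * v y + w y)^`(n)) x 1.
  move=> du dv dw n.
  have dd (h : R -> R) : (forall n (x : R), derivable (derive1n n h) x 1) ->
      forall m (x : R),
        is_derive x (1 : R) (derive1n m h) (derive1n m.+1 h x).
    by move=> dh m x; rewrite derive1nS derive1E; exact/derivableP.
  have H (m : nat) (x : R) : is_derive x (1 : R)
      (a *: derive1n m u + b *: derive1n m v + derive1n m w)
      (a *: derive1n m.+1 u x + b *: derive1n m.+1 v x + derive1n m.+1 w x).
    exact: (is_deriveD (is_deriveD (is_deriveZ a (dd _ du m x))
      (is_deriveZ b (dd _ dv m x))) (dd _ dw m x)).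
  have -> : (fun y => a * u y + b * v y + w y)^`(n) =
            a *: derive1n n u + b *: derive1n n v + derive1n n w.
    elim: n => [|n IH]; first by rewrite !derive1n0.
    rewrite derive1nS IH; apply/funext => x; rewrite derive1E.
    exact: (@derive_val _ _ _ _ _ _ _ (H n x)).
  by move=> x; apply: ex_derive.
move=> n x; split.
- have -> : (fun y => complex.Re ((c *: f + g) y)) =
      (fun y => complex.Re c * complex.Re (f y) + (- complex.Im c) * complex.Im (f y) + complex.Re (g y)).
    apply/funext => y; rewrite /= [in LHS]/GRing.add /= [in LHS]/GRing.scale /=.
    by case: c (f y) (g y) => [a b] [u v] [p q] /=; rewrite mulNr.
  by apply: D => m z; [case: (sf m z) | case: (sf m z) | case: (sg m z)].
- have -> : (fun y => complex.Im ((c *: f + g) y)) =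
      (fun y => complex.Re c * complex.Im (f y) + complex.Im c * complex.Re (f y) + complex.Im (g y)).
    apply/funext => y; rewrite /= [in LHS]/GRing.add /= [in LHS]/GRing.scale /=.
    by case: c (f y) (g y) => [a b] [u v] [p q].
  by apply: D => m z; [case: (sf m z) | case: (sf m z) | case: (sg m z)].
Qed.

Lemma smooth_periodic_submod : submod_closed smooth_periodic.
Proof.
split.
  rewrite inE; split => // n x.
  have E : (fun _ : R => 0 : R)^`(n) = cst 0.
    elim: n => [|n IH]; first by rewrite derive1n0.
    by rewrite derive1nS IH; apply/funext => y; rewrite derive1_cst.
  by split; rewrite [X in derivable X](_ : _ = cst 0) ?E //; apply: derivable_cst.
move=> c f g; rewrite !inE => -[sf pf] [sg pg]; split.
  exact: smooth_linear.
by move=> x /=; rewrite [LHS]/GRing.add /= [in LHS]/GRing.scale /= pf pg.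
Qed.

HB.instance Definition _ :=
  GRing.isSubmodClosed.Build R[i] (R -> R[i]) smooth_periodic
    smooth_periodic_submod.

Record testfun := TestFun {
  testfun_val :> R -> R[i];
  testfunP : testfun_val \in smooth_periodic }.

HB.instance Definition _ := [isSub for testfun_val].
HB.instance Definition _ := [Choice of testfun by <:].
HB.instance Definition _ := [SubChoice_isSubLmodule of testfun by <:].

Definition testfun_seminorm (n : nat) (f : testfun) : R :=
  sup [set normc (nderive n f x) | x in [set: R]].

(* Continuous linear functionals on the C^oo 2pi-periodic functions, for the
   topology given by the seminorms sup |f^(n)|. *)
Record pdistribution := PDistribution {
  pairing :> {scalar testfun};
  pairing_continuous : exists (C : R) (N : nat), forall f : testfun,
    normc (pairing f) <= C * \sum_(n < N) testfun_seminorm n f }.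

(* x |-> exp(-ijx) *)
Definition exp_fun (j : int) (x : R) : R[i] :=
  cos (j%:~R * x) -i* sin (j%:~R * x).

Lemma trig_smooth (c a b : R) (n : nat) (x : R) :
  derivable ((fun y => a * cos (c * y) + b * sin (c * y))^`(n)) x 1.
Proof.
have dlin (y : R) : is_derive y (1 : R) (fun z : R => c * z) c.
  have H := is_deriveZ c (is_derive_id y (1 : R)).
  by apply: is_derive_eq H _; rewrite /GRing.scale /= mulr1.
have dtrig (u v y : R) : is_derive y (1 : R)
    (fun z => u * cos (c * z) + v * sin (c * z))
    (v * c * cos (c * y) + (- (u * c)) * sin (c * y)).
  have dc := is_derive1_comp (is_derive_cos (c * y)) (dlin y).
  have ds := is_derive1_comp (is_derive_sin (c * y)) (dlin y).
  have H := is_deriveD (is_deriveZ u dc) (is_deriveZ v ds).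
  by apply: is_derive_eq H _; rewrite /GRing.scale /=; ring.
have [u [v ->]] : exists u v : R,
    (fun y => a * cos (c * y) + b * sin (c * y))^`(n) =
    (fun y => u * cos (c * y) + v * sin (c * y)).
  elim: n => [|n [u [v IH]]]; first by exists a, b.
  exists (v * c), (- (u * c)); rewrite derive1nS IH.
  apply/funext => y; rewrite derive1E.
  exact: (@derive_val _ _ _ _ _ _ _ (dtrig u v y)).
by have H := dtrig u v x; apply: ex_derive.
Qed.

Lemma exp_fun_smooth_periodic j : exp_fun j \in smooth_periodic.
Proof.
rewrite inE; split=> [n x|x].
  split.
    have -> : (fun y => complex.Re (exp_fun j y)) =
        (fun y => 1 * cos (j%:~R * y) + 0 * sin (j%:~R * y)).
      by apply/funext => y; rewrite mul1r mul0r addr0.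
    exact: trig_smooth.
  have -> : (fun y => complex.Im (exp_fun j y)) =
      (fun y => 0 * cos (j%:~R * y) + (- 1) * sin (j%:~R * y)).
    by apply/funext => y; rewrite mulN1r mul0r add0r.
  exact: trig_smooth.
have per (f : R -> R) : periodic f (pi *+ 2) ->
    f (j%:~R * (x + pi *+ 2)) = f (j%:~R * x).
  move=> pf; rewrite mulrDr; move: (j%:~R * x) => y; rewrite mulrzl.
  case: j => m; first by rewrite -pmulrn (periodicn pf).
  rewrite NegzE mulrNz -pmulrn.
  by rewrite -(periodicn pf m.+1 (_ - _)) subrK.
by rewrite /exp_fun !per //; [exact: sinD2pi | exact: cosD2pi].
Qed.

Definition exp_testfun (j : int) : testfun :=
  TestFun (exp_fun_smooth_periodic j).

(* An integrable function a is identified with f |-> \int_(-pi)^pi a f, whence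
   the factor 1/2pi. *)
Definition fourier_coef (a : pdistribution) (j : int) : R[i] :=
  ((pi *+ 2)^-1)%:C * a (exp_testfun j).

Definition dconv (a : pdistribution) (phi : int -> R[i]) (j : int) : R[i] :=
  \sum_(k \in [set: int]) fourier_coef a (j - k) * phi k.

Definition multiplier_norm (Phi : R -> R) (a : pdistribution) : \bar R :=
  ereal_sup [set (orlicz_norm Phi (dconv a phi) / orlicz_norm Phi phi)%:E |
    phi in [set phi | finitely_supported phi /\ phi <> (fun=> 0)]].

Definition multipliers (Phi : R -> R) : set pdistribution :=
  [set a | (forall phi, finitely_supported phi -> orlicz Phi (dconv a phi)) /\
           (multiplier_norm Phi a < +oo)%E].

End PeriodicDistributions.

(* Main.v *)
(** Write [X0] for l^{Phi_theta} and [g0] for the inverse of [Phi_theta]; up to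
a constant, Phi^{-1}(t) = g0(t)^{1-theta} t^{theta/2}, so l^Phi is intermediate
between [X0] and l^2.

The finite sections [A] of the Laurent matrix of [a] are persymmetric, so A* is
[A] conjugated by the reflection composed with complex conjugation, which
preserves [X0]. Hence A*A is bounded on [X0] by c^2 and, its spectral radius not
depending on the norm, [A] is bounded on l^2 by the same [c] as on [X0].

Interpolation is by the +- method of Gustavsson and Peetre. If
[sum Phi(|u|) <= 1], put s = Phi(|u|), split [u] into pieces [u_i] on which
s^{1/2} / g0(s) is comparable to W_i = tau 2^i, and apply [A] to the sums
[sum_i e_i W_i^{-theta} u_i] and [sum_i e_i W_i^{1-theta} u_i], of bounded norm
in [X0] and in l^2. Averaging over the signs [e_i] gives [H0], [H1] of bounded
modular with |A u_i| <= min(W_i^theta H0, W_i^{theta-1} H1). A geometric sum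
bounds |A u| by H0^{1-theta} H1^theta, which has bounded modular in l^Phi. All
constants are independent of the size of the section. *)

Require Import Defs.
From mathcomp Require Import all_boot all_order all_algebra.
From mathcomp Require Import all_classical all_reals all_analysis.
Import Order.TTheory GRing.Theory Num.Theory.
Local Open Scope ring_scope.
Local Open Scope classical_set_scope.
From mathcomp Require Import complex ring lra zify.
Import numFieldNormedType.Exports.
Import ComplexField.Normc.

Set Implicit Arguments.
Unset Strict Implicit.
Unset Printing Implicit Defensive.

(** * Increasing bijections of the half-line *)

Section HalflineBijections.
Variable R : realType.
Implicit Types (f g F : R -> R) (t x y : R).

(** Common interface to [Phi], [Phi_theta] and their inverses. Carrying the inverse along lets an
    inequality be moved between arguments and values. *)
Record halfline_iso f g : Prop := HalflineIso {
  iso_ge0 : maps_halfline f;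
  iso_inv_ge0 : maps_halfline g;
  isoK : forall x, 0 <= x -> g (f x) = x;
  iso_invK : forall y, 0 <= y -> f (g y) = y;
  iso_le : forall x y, 0 <= x -> 0 <= y -> (f x <= f y) = (x <= y) }.

Lemma halfline_iso_sym f g : halfline_iso f g -> halfline_iso g f.
Proof.
case=> f0 g0 fK gK fle; split => // x y x0 y0.
by rewrite -(fle (g x)) ?gK //; exact: g0.
Qed.

Lemma iso_lt f g : halfline_iso f g ->
  forall x y, 0 <= x -> 0 <= y -> (f x < f y) = (x < y).
Proof. by move=> H x y x0 y0; rewrite !ltNge (iso_le H). Qed.

Lemma iso0 f g : halfline_iso f g -> f 0 = 0.
Proof.
move=> H; apply/eqP; rewrite eq_le (iso_ge0 H) // andbT.
by rewrite -{2}(iso_invK H (lexx 0)) (iso_le H) // (iso_inv_ge0 H).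
Qed.

Lemma iso_gt0 f g : halfline_iso f g -> forall x, 0 < x -> 0 < f x.
Proof. by move=> H x x0; rewrite -(iso0 H) (iso_lt H) // ltW. Qed.

Lemma inv_halfline_iso F : maps_halfline F ->
  {in halfline &, {homo F : x y / x < y}} ->
  (forall y, 0 <= y -> exists2 x, 0 <= x & F x = y) ->
  halfline_iso F (inv_halfline F).
Proof.
move=> F0 Fmono Fsurj.
have mem x : (x \in (halfline : set R)) = (0 <= x).
  by apply/idP/idP; rewrite inE /halfline /= in_itv /= andbT.
have Fle x y : 0 <= x -> 0 <= y -> (F x <= F y) = (x <= y).
  move=> x0 y0; case: (leP x y) => [|yx].
    rewrite le_eqVlt => /predU1P[->|xy]; first by rewrite lexx.
    by apply/ltW/Fmono => //; rewrite mem.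
  by apply/negbTE; rewrite -ltNge; apply: Fmono => //; rewrite mem.
have Fsub y : 0 <= y -> y \in F @` halfline.
  move=> y0; have [x x0 <-] := Fsurj y y0; rewrite inE; exists x => //.
  by move: x0; rewrite -mem inE.
have Finj : {in halfline &, injective F}.
  move=> x y; rewrite !mem => x0 y0 e; apply/eqP; rewrite eq_le.
  by rewrite -(Fle x y) // -(Fle y x) // e lexx.
have g0 : maps_halfline (inv_halfline F).
  move=> y y0; have [x x0 <-] := Fsurj y y0.
  by rewrite /inv_halfline pinvKV // mem.
split => //.
- by move=> x x0; rewrite /inv_halfline pinvKV // mem.
- by move=> y y0; rewrite /inv_halfline pinvK // Fsub.
Qed.

Lemma convex_halflineP f : convex_function halfline f <->
  forall t x y, 0 <= t <= 1 -> 0 <= x -> 0 <= y ->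
    f (t * x + (1 - t) * y) <= t * f x + (1 - t) * f y.
Proof.
have mem x : (x \in (halfline : set R)) = (0 <= x).
  by apply/idP/idP; rewrite inE /halfline /= in_itv /= andbT.
split=> [H t x y t01 x0 y0|H t x y].
  have := H (Itv01 (andP t01).1 (andP t01).2) x y.
  by rewrite !mem => /(_ x0 y0).
by rewrite !mem => x0 y0; apply: H => //; rewrite ge0 le1.
Qed.

Lemma convex_scale_le f t x : convex_function halfline f -> f 0 = 0 ->
  0 <= t <= 1 -> 0 <= x -> f (t * x) <= t * f x.
Proof.
move=> /convex_halflineP cf f0 t01 x0.
by have := cf t x 0 t01 x0 (lexx 0); rewrite f0 !mulr0 !addr0.
Qed.

(** Induction on a list: the head gets weight 1/(n+1) and the average of the n other points gets
    weight n/(n+1). *)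
Lemma jensen_average f (T : finType) (x : T -> R) :
  convex_function halfline f -> (0 < #|T|)%N -> (forall i, 0 <= x i) ->
  f (#|T|%:R^-1 * \sum_i x i) <= #|T|%:R^-1 * \sum_i f (x i).
Proof.
move=> /convex_halflineP cf T0 x0.
have main (s : seq T) : (0 < size s)%N ->
    f ((size s)%:R^-1 * \sum_(i <- s) x i)
      <= (size s)%:R^-1 * \sum_(i <- s) f (x i).
  elim: s => // a s IH _ /=; rewrite !big_cons.
  case: s IH => [_|b s /(_ isT)]; first by rewrite !big_nil /= invr1 !mul1r !addr0.
  move: (b :: s) => {b}s IH.
  have [s0|] := posnP (size s).
    by move/size0nil: s0 => ->; rewrite !big_nil /= invr1 !mul1r !addr0.
  move=> sgt0; set n := (size s)%:R in IH *.
  have n0 : 0 < n :> R by rewrite ltr0n.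
  have n1 : (size s).+1%:R = n + 1 :> R by rewrite -natr1.
  have nn : n + 1 != 0 by rewrite gt_eqF // ltr_wpDl // ltW.
  have t01 : 0 <= (n + 1)^-1 <= 1.
    rewrite invr_ge0 addr_ge0 ?(ltW n0) //= invf_le1 ?lerDr ?(ltW n0) //.
    by rewrite ltr_wpDl // ltW.
  rewrite n1; set S := \sum_(j <- s) x j; set S' := \sum_(j <- s) f (x j).
  have S0 : 0 <= S by apply: sumr_ge0 => *; exact: x0.
  have nS0 : 0 <= n^-1 * S by rewrite mulr_ge0 // invr_ge0 ltW.
  have -> : (n + 1)^-1 * (x a + S) = (n + 1)^-1 * x a + (1 - (n + 1)^-1) * (n^-1 * S).
    by field; rewrite nn gt_eqF.
  apply: (le_trans (cf _ _ _ t01 (x0 a) nS0)).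
  have -> : (n + 1)^-1 * (f (x a) + S') =
      (n + 1)^-1 * f (x a) + (1 - (n + 1)^-1) * (n^-1 * S').
    by field; rewrite nn gt_eqF.
  by rewrite lerD2l ler_wpM2l // subr_ge0; case/andP: t01.
have := main (enum T); rewrite -cardE => /(_ T0).
by rewrite !big_enum.
Qed.

(** Applying the increasing [g] to both sides leaves the concavity of [g] at the points [f x] and
    [f y]. *)
Lemma convex_inverse f g : halfline_iso f g -> concave_function halfline g ->
  convex_function halfline f.
Proof.
move=> H /convex_halflineP cg; apply/convex_halflineP => t x y t01 x0 y0.
have /andP[t0 t1] := t01.
have t1' : 0 <= 1 - t by rewrite subr_ge0.
have fx := iso_ge0 H x0; have fy := iso_ge0 H y0.
have H' := halfline_iso_sym H.
rewrite -(iso_le H') ?(iso_ge0 H) ?addr_ge0 ?mulr_ge0 //.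
rewrite (isoK H) ?addr_ge0 ?mulr_ge0 //.
have := cg t _ _ t01 fx fy; rewrite !(isoK H) //; lra.
Qed.

End HalflineBijections.

(** * The least concave majorant and the indices *)

Section ConcaveMajorant.
Variable R : realType.
Variables (Psi : R -> R) (delta C : R).
Implicit Types s t u x y : R.
Hypothesis Psi00 : Psi 0 = 0.
Hypothesis Psi_gt0 : forall t, 0 < t -> 0 < Psi t.
Hypothesis delta_gt0 : 0 < delta.
(** Up to the factor e^C, [Psi] grows at least like t^delta and at most linearly; thus both Psi(t)
    and t / Psi(t) are almost increasing. *)
Hypothesis Psi_lower : forall s t, 0 < s -> s <= t ->
  delta * (ln t - ln s) - C <= ln (Psi t) - ln (Psi s).
Hypothesis Psi_upper : forall s t, 0 < s -> s <= t ->
  ln (Psi t) - ln (Psi s) <= ln t - ln s + C.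

Let L := least_concave_majorant Psi.

(* Affine on the open half-line, with the value at the end point lowered to 0,
   which preserves concavity. *)
Let tangent (s x : R) : R := if x == 0 then 0 else expR C * Psi s * (1 + x / s).

(** To the left of [s] the constant term dominates [Psi], which is almost increasing; to the right
    the linear term does, by [Psi_upper]. *)
Lemma tangent_majorant s : 0 < s -> concave_majorants Psi (tangent s).
Proof.
move=> s0; have k0 : 0 < expR C * Psi s by rewrite mulr_gt0 ?expR_gt0 ?Psi_gt0.
have pos x : 0 < x -> 0 < tangent s x.
  move=> x0; rewrite /tangent gt_eqF // mulr_gt0 // addr_gt0 //.
  by rewrite divr_gt0.
split.
- move=> x; rewrite le_eqVlt => /predU1P[<-|/pos/ltW //].
  by rewrite /tangent eqxx.
- apply/convex_halflineP => t x y /andP[t0 t1] x0 y0.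
  have t1' : 0 <= 1 - t by lra.
  rewrite /tangent; case: (eqVneq x 0) => [->|xn]; case: (eqVneq y 0) => [->|yn].
  + by rewrite !mulr0 addr0 eqxx oppr0 !mulr0 addr0.
  + rewrite mulr0 add0r oppr0 mulr0 add0r mulf_eq0 (negbTE yn) orbF.
    case: eqP => [->|_]; first by rewrite mul0r oppr0.
    rewrite -subr_ge0 [X in 0 <= X](_ : _ = t * (expR C * Psi s)); last by ring.
    by rewrite mulr_ge0 // ltW.
  + rewrite mulr0 addr0 oppr0 mulr0 addr0 mulf_eq0 (negbTE xn) orbF.
    case: eqP => [->|_]; first by rewrite mul0r oppr0.
    rewrite -subr_ge0 [X in 0 <= X](_ : _ = (1 - t) * (expR C * Psi s)); last by ring.
    by rewrite mulr_ge0 // ltW.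
  + have xp : 0 < x by rewrite lt_neqAle eq_sym xn.
    have yp : 0 < y by rewrite lt_neqAle eq_sym yn.
    rewrite gt_eqF; first by rewrite le_eqVlt; apply/orP; left; apply/eqP; ring.
    by move: t0; rewrite le_eqVlt => /predU1P[<-|t0]; nra.
- move=> t; rewrite le_eqVlt => /predU1P[<-|t0]; first by rewrite /tangent eqxx.
  by split=> e; [have := pos t t0 | move: t0]; rewrite e ltxx.
- move=> x; rewrite le_eqVlt => /predU1P[<-|x0]; first by rewrite /tangent eqxx Psi00.
  rewrite /tangent gt_eqF //.
  have xs0 : 0 < x / s by rewrite divr_gt0.
  have [xs|sx] := leP x s.
    rewrite (@le_trans _ _ (expR C * Psi s)) //; last first.
      by rewrite ler_peMr ?lerDl // ltW.
    rewrite -ler_ln ?posrE ?Psi_gt0 // lnM ?posrE ?expR_gt0 ?Psi_gt0 // expRK.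
    have := Psi_lower x0 xs; have := ler_ln x0 s0; rewrite xs => lnle H.
    have : 0 <= delta * (ln s - ln x) by rewrite mulr_ge0 ?(ltW delta_gt0) // subr_ge0.
    by lra.
  rewrite (@le_trans _ _ (expR C * Psi s * (x / s))) //; last first.
    by rewrite ler_wpM2l ?lerDr // ltW.
  have ks : 0 < expR C * Psi s * (x / s) by rewrite mulr_gt0.
  rewrite -ler_ln ?posrE ?Psi_gt0 //.
  rewrite !lnM ?posrE ?mulr_gt0 ?invr_gt0 ?expR_gt0 ?Psi_gt0 // lnV ?posrE // expRK.
  by have := Psi_upper s0 (ltW sx); lra.
Qed.

Lemma Psi_le_majorant t : 0 <= t -> Psi t <= L t.
Proof.
move=> t0; apply: lb_le_inf.
  (* The family must be seen to be nonempty, since the infimum of the empty set is 0 by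
     convention. *)
  by exists (tangent 1 t), (tangent 1) => //; exact: tangent_majorant.
by move=> _ [F [_ _ _ FP] <-]; exact: FP.
Qed.

Lemma majorant_inf_has_lbound t : 0 <= t ->
  has_lbound [set F t | F in concave_majorants Psi].
Proof. by move=> t0; exists 0 => _ [F [F0 _ _ _] <-]; exact: F0. Qed.

(** The infimum is tested on [tangent t], whose value at [t] itself is 2 e^C Psi(t). *)
Lemma majorant_le t : 0 <= t -> L t <= expR C * 2 * Psi t.
Proof.
rewrite le_eqVlt => /predU1P[<-|t0].
  rewrite Psi00 mulr0; apply: ge_inf; first exact: majorant_inf_has_lbound.
  by exists (tangent 1); [exact: tangent_majorant | rewrite /tangent eqxx].
apply: ge_inf; first by apply: majorant_inf_has_lbound; exact: ltW.
exists (tangent t); first exact: tangent_majorant.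
by rewrite /tangent gt_eqF // divff ?gt_eqF //; ring.
Qed.

Lemma majorant_concave : concave_function halfline L.
Proof.
apply/convex_halflineP => t x y /andP[t0 t1] x0 y0.
have t1' : 0 <= 1 - t by lra.
suff : t * L x + (1 - t) * L y <= L (t * x + (1 - t) * y) by lra.
apply: lb_le_inf.
  by exists (tangent 1 (t * x + (1 - t) * y)), (tangent 1) => //; exact: tangent_majorant.
move=> _ [F HF <-]; have [_ /convex_halflineP cF _ _] := HF.
have := cF t x y; rewrite t0 t1 => /(_ isT x0 y0).
have Fx : L x <= F x by apply: ge_inf; [exact: majorant_inf_has_lbound | exists F].
have Fy : L y <= F y by apply: ge_inf; [exact: majorant_inf_has_lbound | exists F].
by have := ler_wpM2l t0 Fx; have := ler_wpM2l t1' Fy; lra.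
Qed.

Lemma Psi_unbounded y : exists2 u0 : R, 0 < u0 & forall u, u0 <= u -> y < Psi u.
Proof.
(* [z] is the value of ln u at which [Psi_lower] between 1 and u forces Psi(u) >= 1 + |y|; the
   maximum with 0 ensures 1 <= u. *)
pose z := Num.max 0 ((ln (1 + `|y|) + C - ln (Psi 1)) / delta).
exists (expR z) => [|u uz]; first exact: expR_gt0.
have u1 : 1 <= u by apply: le_trans uz; rewrite -expR0 ler_expR le_max lexx.
have u0 : 0 < u by apply: lt_le_trans u1.
have y1 : 0 < 1 + `|y| by rewrite ltr_pwDl.
apply: (@lt_le_trans _ _ (1 + `|y|)).
  by rewrite ltr_pwDl // ler_norm.
rewrite -ler_ln ?posrE ?Psi_gt0 //.
have := Psi_lower ltr01 u1; rewrite ln1 subr0.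
have : z <= ln u by rewrite -(expRK z) ler_ln ?posrE ?expR_gt0.
have : (ln (1 + `|y|) + C - ln (Psi 1)) / delta <= z by rewrite le_max lexx orbT.
rewrite ler_pdivrMr // => h1 h2.
by have := ler_wpM2l (ltW delta_gt0) h2; lra.
Qed.

Lemma Psi_small y : 0 < y -> exists2 s : R, 0 < s & Psi s <= y.
Proof.
move=> y0; pose z := Num.max 0 ((ln (Psi 1) + C - ln y) / delta).
have z0 : 0 <= z by rewrite le_max lexx.
have e0 : 0 < expR (- z) by rewrite expR_gt0.
exists (expR (- z)) => //.
rewrite -ler_ln ?posrE ?Psi_gt0 //.
have /(Psi_lower e0) : expR (- z) <= 1 by rewrite -expR0 ler_expR oppr_le0.
rewrite ln1 expRK sub0r opprK.
have : (ln (Psi 1) + C - ln y) / delta <= z by rewrite le_max lexx orbT.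
by rewrite ler_pdivrMr //; lra.
Qed.

(** A concave unbounded function cannot stop growing: a point u > y with L(u) > L(x) exists, and
    concavity between x and u lifts L(y) strictly above L(x). *)
Lemma majorant_increasing x y : 0 <= x -> x < y -> L x < L y.
Proof.
move=> x0 xy; rewrite ltNge; apply/negP => Lyx.
have [u0 u0_gt0 Hu] := Psi_unbounded (L x).
pose u := y + u0.
have yu : y < u by rewrite ltrDl.
have y0 : 0 < y := le_lt_trans x0 xy.
have u0' : 0 < u by exact: lt_trans yu.
have Lu : L x < L u.
  by apply: lt_le_trans (Psi_le_majorant (ltW u0')); apply: Hu; rewrite lerDr ltW.
have ux : 0 < u - x by rewrite subr_gt0 (lt_trans xy).
pose t := (u - y) / (u - x).
have t01 : 0 <= t <= 1.
  rewrite /t divr_ge0 ?(ltW ux) ?subr_ge0 ?(ltW yu) //=.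
  by rewrite ler_pdivrMr // mul1r lerD2l lerN2 ltW.
have e : t * x + (1 - t) * u = y by rewrite /t; field; rewrite gt_eqF.
have /convex_halflineP cL := majorant_concave.
have := cL t x u t01 x0 (ltW u0'); rewrite e.
have t1 : 0 < 1 - t by rewrite subr_gt0 /t ltr_pdivrMr // mul1r ltrD2l ltrN2.
have : 0 < (1 - t) * (L u - L x) by rewrite mulr_gt0 // subr_gt0.
by lra.
Qed.

Lemma majorant0 : L 0 = 0.
Proof.
apply/eqP; rewrite eq_le; apply/andP; split.
  by rewrite (le_trans (majorant_le (lexx 0))) // Psi00 mulr0.
by rewrite -{1}Psi00 Psi_le_majorant.
Qed.

(** Slopes of chords from the origin decrease, by concavity. This serves as a quantitative form of
    continuity in the proof of surjectivity. *)
Lemma majorant_ratio x y : 0 < x -> x <= y -> x * L y <= y * L x.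
Proof.
move=> x0 xy; have y0 : 0 < y := lt_le_trans x0 xy.
have t01 : 0 <= x / y <= 1.
  by rewrite divr_ge0 ?(ltW x0) ?(ltW y0) //= ler_pdivrMr // mul1r.
have /convex_halflineP cL := majorant_concave.
have := cL (x / y) y 0 t01 (ltW y0) (lexx 0).
rewrite majorant0 mulr0 addr0 oppr0 mulr0 addr0 divfK ?gt_eqF // mulrN lerN2.
move=> /(ler_wpM2l (ltW y0)); rewrite mulrA mulrCA divff ?gt_eqF // mulr1.
by [].
Qed.

(** The preimage is the supremum of the points where [L] is at most [y]; [majorant_ratio] excludes a
    jump on either side of it. *)
Lemma majorant_surjective y : 0 <= y -> exists2 x, 0 <= x & L x = y.
Proof.
rewrite le_eqVlt => /predU1P[<-|y0]; first by exists 0; rewrite ?majorant0.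
pose E := [set x | 0 <= x /\ L x <= y].
have [u0 u00 Hu] := Psi_unbounded y.
have Lmono a b : 0 <= a -> a <= b -> L a <= L b.
  move=> a0; rewrite le_eqVlt => /predU1P[->//|ab].
  exact/ltW/majorant_increasing.
have ubE : ubound E u0.
  move=> x [x0 Lx]; rewrite leNgt; apply/negP => ux.
  have := Hu x (ltW ux); rewrite ltNge => /negP; apply.
  exact: le_trans (Psi_le_majorant x0) Lx.
have K0 : 0 < expR C * 2 by rewrite mulr_gt0 ?expR_gt0.
have [s s0 Ps] := Psi_small (divr_gt0 y0 K0).
have Es : E s.
  split; first exact: ltW.
  apply: le_trans (majorant_le (ltW s0)) _.
  by move: Ps; rewrite ler_pdivlMr // mulrC.
have hsE : has_sup E by split; [exists s | exists u0].
pose x := sup E.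
have sx : s <= x by apply: sup_upper_bound.
have x0 : 0 < x := lt_le_trans s0 sx.
have Lx0 : 0 <= L x by rewrite -majorant0 Lmono // ltW.
exists x; first exact: ltW.
apply/eqP; rewrite eq_le; apply/andP; split.
  apply/ler_addgt0Pr => e e0.
  (* With this margin the point [a] exceeds x y / (y + e), so L(x) <= (x / a) L(a) <= y + e. *)
  have d0 : 0 < x * e / (y + e) by rewrite divr_gt0 ?mulr_gt0 ?addr_gt0.
  have [a [a0 La] xa] := sup_adherent d0 hsE.
  have ax : a <= x by apply: sup_upper_bound.
  have ap : 0 < a.
    apply: le_lt_trans xa; rewrite -/x subr_ge0 ler_pdivrMr ?addr_gt0 //.
    by rewrite ler_wpM2l ?lerDr // ltW.
  have H1 := majorant_ratio ap ax.
  have H2 : x * y <= a * (y + e).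
    move: xa; rewrite -/x -(ltr_pM2r (addr_gt0 y0 e0)) mulrBl divfK ?gt_eqF ?addr_gt0 //.
    by move=> /ltW; lra.
  rewrite -(ler_pM2l ap); apply: le_trans H1 (le_trans _ H2).
  by rewrite ler_wpM2l // ltW.
rewrite leNgt; apply/negP => Lxy.
have b0 : 0 < (1 + y) by lra.
(* [b] lies beyond the supremum, yet L(b) <= (b / x) L(x) <= L(x) + (y - L(x)) because L(x) <= 1 +
   y. *)
pose b := x * (1 + (y - L x) / (1 + y) ).
have c0 : 0 < (y - L x) / (1 + y) by rewrite divr_gt0 // subr_gt0.
have xb : x < b by rewrite /b ltr_pMr // ltrDl.
suff : E b by move=> /(sup_upper_bound hsE); rewrite leNgt xb.
split; first by rewrite ltW // (lt_trans x0).
rewrite -(ler_pM2l x0); apply: le_trans (majorant_ratio x0 (ltW xb)) _.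
rewrite /b -mulrA ler_wpM2l ?(ltW x0) //.
have : L x * ((y - L x) / (1 + y)) <= y - L x; last by lra.
rewrite mulrA ler_pdivrMr // mulrC ler_wpM2l ?subr_ge0 ?(ltW Lxy) //; lra.
Qed.

Lemma majorant_iso : halfline_iso L (inv_halfline L).
Proof.
apply: inv_halfline_iso.
- move=> t t0; apply: le_trans (Psi_le_majorant t0).
  by move: t0; rewrite le_eqVlt => /predU1P[<-|/Psi_gt0/ltW]; rewrite ?Psi00.
- move=> x y; rewrite !inE /halfline /= !in_itv /= !andbT => x0 _.
  exact: majorant_increasing.
- exact: majorant_surjective.
Qed.

End ConcaveMajorant.

(** * Power growth of an N-function from its Matuszewska-Orlicz indices *)

Section Indices.
Variable R : realType.
Variable Phi : R -> R.
Implicit Types a b p q r t u x y : R.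
Hypothesis hPhi : is_Nfunction Phi.

Let Phi_incr x y : 0 <= x -> x < y -> Phi x < Phi y.
Proof.
move=> x0 xy; apply: (Nfun_increasing hPhi) => //;
  rewrite inE /halfline /= in_itv /= andbT //.
exact: le_trans (ltW xy).
Qed.

Let Phi_le x y : 0 <= x -> x <= y -> Phi x <= Phi y.
Proof. by move=> x0; rewrite le_eqVlt => /predU1P[->//|xy]; exact/ltW/Phi_incr. Qed.

Lemma Nfun0 : Phi 0 = 0.
Proof. exact/(Nfun_eq0 hPhi (lexx 0)). Qed.

Lemma Nfun_gt0 x : 0 < x -> 0 < Phi x.
Proof. by move=> x0; rewrite -Nfun0 Phi_incr. Qed.

Lemma Nfun_unbounded y : exists2 x, 0 <= x & y <= Phi x.
Proof.
have /cvgryPge/(_ (Num.max y 0)) [M [Mr HM]] := Nfun_slopey hPhi.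
pose x := Num.max 1 (`|M| + 1).
have x1 : 1 <= x by rewrite le_max lexx.
exists x; first exact: le_trans x1.
have /HM /= : M < x.
  by rewrite lt_max ltr_pwDr ?orbT // ler_norm.
rewrite ler_pdivlMr ?(lt_le_trans ltr01) // => H.
have y0 : 0 <= Num.max y 0 by rewrite le_max lexx orbT.
apply: le_trans H; apply: (@le_trans _ _ (Num.max y 0)); first by rewrite le_max lexx.
by rewrite ler_peMr.
Qed.

Lemma Nfun_iso : halfline_iso Phi (inv_halfline Phi).
Proof.
apply: inv_halfline_iso; [exact: Nfun_halfline hPhi | exact: Nfun_increasing hPhi |].
move=> y y0; have [b b0 yb] := Nfun_unbounded y.
have cb : {within `[0, b], continuous Phi}.
  apply: continuous_subspaceW (Nfun_continuous hPhi) => x /=.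
  by rewrite /halfline /= !in_itv /= => /andP[-> _].
have yb' : Num.min (Phi 0) (Phi b) <= y <= Num.max (Phi 0) (Phi b).
  by rewrite Nfun0 ge_min y0 /= le_max yb orbT.
have [x] := @IVT R Phi 0 b y b0 cb yb'.
by rewrite in_itv /= => /andP[x0 _] <-; exists x.
Qed.

Lemma dilation_real t : 0 < t -> dilation Phi t = +oo%E \/
  exists2 r, 0 < r & dilation Phi t = r%:E /\
    forall u, 0 < u -> Phi (t * u) <= r * Phi u.
Proof.
move=> t0.
have ub u : 0 < u -> ((Phi (t * u) / Phi u)%:E <= dilation Phi t)%E.
  by move=> u0; apply: ereal_sup_ubound; exists u.
have p1 : 0 < Phi (t * 1) / Phi 1 by rewrite divr_gt0 ?Nfun_gt0 ?mulr1.
case E : (dilation Phi t) => [r| |]; [right|by left|].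
- exists r; first by have := ub 1 ltr01; rewrite E lee_fin; exact: lt_le_trans.
  split=> // u u0; have := ub u u0; rewrite E lee_fin.
  by rewrite ler_pdivrMr // Nfun_gt0.
- by have := ub 1 ltr01; rewrite E leeNy_eq.
Qed.

Lemma upper_index_dilation p : 0 < p -> (MO_upper Phi < p%:E)%E ->
  exists t p', [/\ 1 < t, 0 < p' < p & forall u, 0 < u -> Phi (t * u) <= t `^ p' * Phi u].
Proof.
move=> p0 /ereal_inf_lt [_ [t /= + <-]]; rewrite in_itv /= andbT => t1.
have t0 : 0 < t := lt_trans ltr01 t1.
have lt0 : 0 < ln t by rewrite ln_gt0.
have [->|[r r0 [-> Hr]]] := dilation_real t0.
  (* An infinite dilation makes the quotient +oo, since ln t > 0, and this is not below [p]. *)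
  by rewrite /= mulyr gtr0_sg ?invr_gt0 // mul1e.
rewrite lne_EFin // -EFinM lte_fin => H.
(* The maximum with p / 2 keeps the exponent positive; it only weakens the bound, as t > 1. *)
exists t, (Num.max (ln r / ln t) (p / 2)); split => //.
  by rewrite lt_max gt_max H; lra.
move=> u u0; apply: le_trans (Hr u u0) _.
rewrite ler_pM2r ?Nfun_gt0 //.
rewrite -[leLHS](@lnK _ r) ?posrE // -[leRHS](@lnK _ _) ?posrE ?powR_gt0 // ler_expR ln_powR.
rewrite -ler_pdivrMr // le_max lexx //.
Qed.

Lemma lower_index_dilation q : (q%:E < MO_lower Phi)%E ->
  exists t, 0 < t < 1 /\ forall u, 0 < u -> Phi (t * u) <= t `^ q * Phi u.
Proof.
move=> /ereal_sup_gt [_ [t /= + <-]]; rewrite in_itv /= => /andP[t0 t1].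
have lt0 : ln t < 0 by rewrite ln_lt0 // t0.
have [->|[r r0 [-> Hr]]] := dilation_real t0.
  (* Here ln t < 0, so an infinite dilation makes the quotient -oo, which is not above [q]. *)
  by rewrite /= mulyr ltr0_sg ?invr_lt0 // mulN1e.
rewrite lne_EFin // -EFinM lte_fin => H.
exists t; split; first by rewrite t0.
move=> u u0; apply: le_trans (Hr u u0) _.
rewrite ler_pM2r ?Nfun_gt0 // -ler_ln ?posrE ?powR_gt0 // ln_powR.
by rewrite -ler_ndivlMr // ltW.
Qed.

Let iter_dilation t c : 0 < t -> 0 <= c ->
  (forall u, 0 < u -> Phi (t * u) <= c * Phi u) ->
  forall n u, 0 < u -> Phi (t ^+ n * u) <= c ^+ n * Phi u.
Proof.
move=> t0 c0 H; elim=> [|n IH] u u0; first by rewrite !expr0 !mul1r.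
rewrite exprS -mulrA (le_trans (H _ _)) ?mulr_gt0 ?exprn_gt0 //.
by rewrite exprS -mulrA ler_wpM2l // IH.
Qed.

(** A single good dilation [t] is iterated, and monotonicity of [Phi] fills the gaps between powers
    of [t]; this costs one extra factor, whence the constant p' ln t. *)
Lemma upper_index_ln p : 0 < p -> (MO_upper Phi < p%:E)%E ->
  exists p' C, 0 < p' < p /\ forall a b, 0 < a -> a <= b ->
    ln (Phi b) - ln (Phi a) <= p' * (ln b - ln a) + C.
Proof.
move=> p0 /(upper_index_dilation p0) [t [p' [t1 p'b H]]].
have /andP[p'0 _] := p'b.
have t0 : 0 < t := lt_trans ltr01 t1.
have lt0 : 0 < ln t by rewrite ln_gt0.
exists p', (p' * ln t); split => // a b a0 ab.
have b0 : 0 < b := lt_le_trans a0 ab.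
have lab : 0 <= (ln b - ln a) / ln t by rewrite divr_ge0 ?(ltW lt0) // subr_ge0 ler_ln.
have /andP[n1 n2] := truncn_itv lab; set n := Num.truncn _ in n1 n2.
(* [n] is the integer part of the logarithm of b / a to base t, so n + 1 steps are needed to pass
   [b]. *)
have nb : b <= t ^+ n.+1 * a.
  rewrite -ler_ln ?posrE ?mulr_gt0 ?exprn_gt0 // lnM ?posrE ?exprn_gt0 // lnXn //.
  move: n2; rewrite ltr_pdivrMr // => /ltW n2.
  by rewrite -mulr_natl; lra.
have := le_trans (Phi_le (ltW b0) nb) (iter_dilation t0 (powR_ge0 t p') H n.+1 a0).
rewrite -ler_ln ?posrE ?Nfun_gt0 ?mulr_gt0 ?exprn_gt0 ?powR_gt0 ?Nfun_gt0 //.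
rewrite lnM ?posrE ?exprn_gt0 ?powR_gt0 ?Nfun_gt0 // lnXn ?powR_gt0 // ln_powR -mulr_natl.
move: n1; rewrite ler_pdivlMr // -natr1 => n1.
have := ler_wpM2l (ltW p'0) n1.
move: (ln (Phi b)) (ln (Phi a)) (ln a) (ln b) (ln t) (n%:R : R).
by clear; move=> *; lra.
Qed.

(** The same iteration, now downwards from [b] with t < 1; it stops at the last power that is still
    above [a]. *)
Lemma lower_index_ln q : 0 <= q -> (q%:E < MO_lower Phi)%E ->
  exists C, forall a b, 0 < a -> a <= b ->
    q * (ln b - ln a) - C <= ln (Phi b) - ln (Phi a).
Proof.
move=> q0 /lower_index_dilation [t [/andP[t0 t1] H]].
have lt0 : 0 < - ln t by rewrite oppr_gt0 ln_lt0 // t0.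
exists (q * - ln t) => a b a0 ab.
have b0 : 0 < b := lt_le_trans a0 ab.
have lab : 0 <= (ln b - ln a) / - ln t by rewrite divr_ge0 ?(ltW lt0) // subr_ge0 ler_ln.
have /andP[n1 n2] := truncn_itv lab; set n := Num.truncn _ in n1 n2.
have nb : a <= t ^+ n * b.
  rewrite -ler_ln ?posrE ?mulr_gt0 ?exprn_gt0 // lnM ?posrE ?exprn_gt0 // lnXn //.
  move: n1; rewrite ler_pdivlMr // => n1.
  by rewrite -mulr_natl; lra.
have := le_trans (Phi_le (ltW a0) nb) (iter_dilation t0 (powR_ge0 t q) H n b0).
rewrite -ler_ln ?posrE ?Nfun_gt0 ?mulr_gt0 ?exprn_gt0 ?powR_gt0 ?Nfun_gt0 //.
rewrite lnM ?posrE ?exprn_gt0 ?powR_gt0 ?Nfun_gt0 // lnXn ?powR_gt0 // ln_powR -mulr_natl.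
move: n2; rewrite ltr_pdivrMr // -natr1 => /ltW n2.
have := ler_wpM2l q0 n2.
move: (ln (Phi b)) (ln (Phi a)) (ln a) (ln b) (ln t) (n%:R : R).
by clear; move=> *; lra.
Qed.

End Indices.

(** * The function [Phi_theta] and its inverse *)

Section PhiTheta.
Variable R : realType.
Variables (Phi : R -> R) (theta : R).
Implicit Types s t : R.
Hypothesis hPhi : is_Nfunction Phi.
Hypothesis halpha : (1 < MO_lower Phi)%E.
Hypothesis halphabeta : (MO_lower Phi <= MO_upper Phi)%E.
Hypothesis hbeta : (MO_upper Phi < +oo)%E.
Hypothesis htheta0 : 0 < theta.
Hypothesis htheta : theta < 2 * Num.min (fine (MO_upper Phi))^-1
                                  (1 - (fine (MO_lower Phi))^-1).

(** Both indices are finite, so [fine] returns their actual values. *)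
Let index_bounds : exists a b : R, [/\ MO_lower Phi = a%:E, MO_upper Phi = b%:E,
  1 < a, a <= b & theta / 2 < b^-1 /\ theta / 2 < 1 - a^-1].
Proof.
move: halpha halphabeta hbeta htheta.
case: (MO_lower Phi) => [a| |]; case: (MO_upper Phi) => [b| |] //=.
rewrite !lte_fin !lee_fin => a1 ab _ th; exists a, b; split => //.
have : theta / 2 < Num.min b^-1 (1 - a^-1) by lra.
by rewrite lt_min => /andP[].
Qed.

(** Add theta/2 < 1/b <= 1/a and theta/2 < 1 - 1/a. *)
Lemma theta_lt1 : theta < 1.
Proof.
have [a [b [_ _ a1 ab [h1 h2]]]] := index_bounds.
have a0 : 0 < a by lra.
have : b^-1 <= a^-1 by rewrite lef_pV2 ?posrE // (lt_le_trans a0).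
lra.
Qed.

Local Notation G := (inv_halfline Phi).
Local Notation Psi := (Psi_theta Phi theta).

Let G_gt0 t : 0 < t -> 0 < G t.
Proof. exact: iso_gt0 (halfline_iso_sym (Nfun_iso hPhi)) t. Qed.

Lemma Psi_theta_ln t : 0 < t ->
  ln (Psi t) = (ln (G t) - theta / 2 * ln t) / (1 - theta).
Proof.
move=> t0; rewrite /Psi_theta gt_eqF // ln_powR lnM ?posrE ?powR_gt0 ?G_gt0 //.
by rewrite ln_powR; ring.
Qed.

Let Psi_theta_lnB s t : 0 < s -> 0 < t -> ln (Psi t) - ln (Psi s) =
  (ln (G t) - ln (G s) - theta / 2 * (ln t - ln s)) / (1 - theta).
Proof.
have arith (A B a b y z : R) : y = (a - theta / 2 * A) / (1 - theta) ->
    z = (b - theta / 2 * B) / (1 - theta) ->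
    z - y = (b - a - theta / 2 * (B - A)) / (1 - theta).
  by move=> -> ->; ring.
by move=> s0 t0; exact: arith (Psi_theta_ln s0) (Psi_theta_ln t0).
Qed.

(** Each half of the condition on [theta] gives one bound. From beta < 2/theta, the inverse of [Phi]
    grows faster than t^(theta/2), so delta > 0. From alpha > 1/(1 - theta/2), it grows at most like
    t^(1 - theta/2); dividing by t^(theta/2) and taking the power 1/(1 - theta) leaves linear
    growth. *)
Lemma Psi_theta_quasiconcave : exists delta C, [/\ 0 < delta,
  (forall s t, 0 < s -> s <= t -> delta * (ln t - ln s) - C <= ln (Psi t) - ln (Psi s)) &
  (forall s t, 0 < s -> s <= t -> ln (Psi t) - ln (Psi s) <= ln t - ln s + C)].
Proof.
have [a [b [Ea Eb a1 ab [h1 h2]]]] := index_bounds.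
have th1 := theta_lt1.
have a0 : 0 < a by lra.
have b0 : 0 < b by lra.
have p0 : 0 < 2 / theta by rewrite divr_gt0.
have upper : (MO_upper Phi < (2 / theta)%:E)%E.
  rewrite Eb lte_fin ltr_pdivlMr //.
  by move: h1; rewrite -[X in _ < X]mul1r ltr_pdivlMr //; lra.
have q0 : 0 < 1 - theta / 2 by lra.
have lower : ((1 - theta / 2)^-1%:E < MO_lower Phi)%E.
  rewrite Ea lte_fin -[X in _ < X]invrK ltf_pV2 ?posrE ?invr_gt0 //; lra.
have [p [C1 [/andP[pp0 pp] H1]]] := upper_index_ln hPhi p0 upper.
have q0' : 0 <= (1 - theta / 2)^-1 by rewrite invr_ge0 ltW.
have [C2 H2] := lower_index_ln hPhi q0' lower.
have I := Nfun_iso hPhi.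
have key s t : 0 < s -> s <= t ->
    ln t - ln s <= p * (ln (G t) - ln (G s)) + C1 /\
    (1 - theta / 2)^-1 * (ln (G t) - ln (G s)) - C2 <= ln t - ln s.
  move=> s0 st; have t0 : 0 < t := lt_le_trans s0 st.
  have Gst : G s <= G t by rewrite (iso_le (halfline_iso_sym I)) // ltW.
  have := H1 _ _ (G_gt0 s0) Gst; have := H2 _ _ (G_gt0 s0) Gst.
  by rewrite !(iso_invK I) ?(ltW s0) ?(ltW t0).
have u0 : 0 < 1 - theta by lra.
have pinv : theta / 2 < p^-1.
  by rewrite -[X in _ < X]mul1r ltr_pdivlMr //; move: pp; rewrite ltr_pdivlMr //; lra.
have d0 : 0 < p^-1 - theta / 2 by lra.
have C10 : 0 <= C1.
  by have := H1 1 1 ltr01 (lexx 1); rewrite !subrr mulr0 add0r.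
have C20 : 0 <= C2.
  by have := H2 1 1 ltr01 (lexx 1); rewrite !subrr mulr0 sub0r; lra.
exists ((p^-1 - theta / 2) / (1 - theta)).
(* One constant for both bounds: [C1 / p] comes from inverting the upper estimate of [Phi], the
   other term from the lower one. *)
exists ((C1 / p + (1 - theta / 2) * C2) / (1 - theta)); split.
- by rewrite divr_gt0.
- move=> s t s0 st; have [K1 K2] := key s t s0 st.
  have t0 : 0 < t := lt_le_trans s0 st.
  rewrite Psi_theta_lnB // mulrAC -mulrBl ler_pM2r ?invr_gt0 //.
  set T := ln t - ln s in K1 *; set D := ln (G t) - ln (G s) in K1.
  have E1 : T / p <= D + C1 / p.
    by rewrite ler_pdivrMr // mulrDl divfK ?gt_eqF // [D * p]mulrC.
  have := mulr_ge0 (ltW q0) C20; rewrite /T /D in E1 *; lra.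
- move=> s t s0 st; have [K1 K2] := key s t s0 st.
  have t0 : 0 < t := lt_le_trans s0 st.
  rewrite Psi_theta_lnB // ler_pdivrMr // mulrDl divfK ?gt_eqF //.
  have := ler_wpM2l (ltW q0) K2; rewrite mulrBr mulrA divff ?gt_eqF // mul1r.
  have : 0 <= C1 / p by rewrite divr_ge0 // ltW.
  lra.
Qed.

Let Psi0 : Psi 0 = 0.
Proof. by rewrite /Psi_theta eqxx. Qed.

Let Psi_gt0 t : 0 < t -> 0 < Psi t.
Proof.
by move=> t0; rewrite /Psi_theta gt_eqF // powR_gt0 // mulr_gt0 ?powR_gt0 ?G_gt0.
Qed.

Lemma Psi_theta_factor t : 0 <= t -> G t = Psi t `^ (1 - theta) * t `^ (theta / 2).
Proof.
have th1 := theta_lt1.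
rewrite le_eqVlt => /predU1P[<-|t0].
  rewrite Psi0 powR0 ?mul0r; last by rewrite subr_eq0 gt_eqF.
  exact: iso0 (halfline_iso_sym (Nfun_iso hPhi)).
rewrite /Psi_theta gt_eqF // -powRrM mulVf; last by rewrite subr_eq0 gt_eqF.
rewrite powRr1 ?mulr_ge0 ?powR_ge0 ?(ltW (G_gt0 _)) //.
by rewrite powRN divfK // gt_eqF // powR_gt0.
Qed.

(** [g] is the least concave majorant. It lies between Psi and 2 e^C Psi; raising this to the power
    1 - theta and multiplying by t^(theta/2) turns [Psi] into the inverse of [Phi]. *)
Lemma Phi_theta_interpolation : exists2 K, 0 < K &
  exists g, [/\ halfline_iso (Phi_theta Phi theta) g,
    convex_function halfline (Phi_theta Phi theta),
    (forall t, 0 <= t -> G t <= g t `^ (1 - theta) * t `^ (theta / 2)) &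
    (forall t, 0 <= t -> g t `^ (1 - theta) * t `^ (theta / 2) <= K * G t)].
Proof.
have th1 := theta_lt1.
have [delta [C [d0 lo up]]] := Psi_theta_quasiconcave.
exists ((expR C * 2) `^ (1 - theta)); first by rewrite powR_gt0 // mulr_gt0 ?expR_gt0.
have I := majorant_iso Psi0 Psi_gt0 d0 lo up.
have J := halfline_iso_sym I.
have Pge t : 0 <= t -> 0 <= Psi t.
  by rewrite le_eqVlt => /predU1P[<-|/Psi_gt0/ltW //]; rewrite Psi0.
have e0 : 0 <= 1 - theta by lra.
exists (least_concave_majorant Psi); split => //.
- apply: (convex_inverse J); exact: (majorant_concave Psi0 Psi_gt0 d0 lo up).
- move=> t t0; rewrite Psi_theta_factor // ler_wpM2r ?powR_ge0 //.
  apply: ge0_ler_powR => //; rewrite ?nnegrE ?Pge ?(iso_ge0 I) //.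
  exact: (Psi_le_majorant Psi0 Psi_gt0 d0 lo up).
- move=> t t0; rewrite Psi_theta_factor // mulrA ler_wpM2r ?powR_ge0 //.
  have K0 : 0 <= expR C * 2 by rewrite mulr_ge0 ?expR_ge0.
  rewrite -powRM ?Pge //.
  apply: ge0_ler_powR => //; rewrite ?nnegrE ?mulr_ge0 ?Pge ?(iso_ge0 I) ?expR_ge0 //.
  exact: (majorant_le Psi0 Psi_gt0 d0 lo up).
Qed.

End PhiTheta.

(** * The l^2 bound for finite Toeplitz sections *)

Section FiniteModular.
Variable R : realType.
Local Notation C := R[i].
Implicit Types (f g : R -> R) (c mu : R) (N : nat).

Definition fmodular f N (u : 'cV[C]_N) mu : R :=
  \sum_i f (normc (u i ord0) / mu).

(** A bound [c] for [A] in the Luxemburg norm, phrased with modulars so that no infimum appears. *)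
Definition modular_bounded f c N (A : 'M[C]_N) : Prop :=
  forall u mu, 0 < mu -> fmodular f u mu <= 1 ->
    fmodular f (A *m u) (c * mu) <= 1.

Lemma normc_ge0 (z : C) : 0 <= normc z.
Proof. by case: z => a b; exact: sqrtr_ge0. Qed.

Lemma normc_sqr (z : C) : normc z ^+ 2 = complex.Re z ^+ 2 + complex.Im z ^+ 2.
Proof. by case: z => a b; rewrite sqr_sqrtr // addr_ge0 // sqr_ge0. Qed.

Lemma normc_conj (z : C) : normc (conjc z) = normc z.
Proof. by case: z => a b; rewrite /normc /= sqrrN. Qed.

Definition l2sum N (u : 'cV[C]_N) : R := \sum_i normc (u i ord0) ^+ 2.

Lemma l2sum_ge0 N (u : 'cV[C]_N) : 0 <= l2sum u.
Proof. by apply: sumr_ge0 => i _; rewrite sqr_ge0. Qed.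

(** Real part of the Hermitian inner product, so that it is symmetric and the moments below are
    real. *)
Definition rdot N (x y : 'cV[C]_N) : R :=
  \sum_i complex.Re (x i ord0 * conjc (y i ord0)).

Lemma rdotC N (x y : 'cV[C]_N) : rdot x y = rdot y x.
Proof.
apply: eq_bigr => i _; case: (x i _) (y i _) => a b [c d] /=.
by rewrite !mulrN !opprK ![a * _]mulrC ![b * _]mulrC.
Qed.

Lemma rdot_self N (x : 'cV[C]_N) : rdot x x = l2sum x.
Proof.
apply: eq_bigr => i _; rewrite normc_sqr; case: (x i _) => a b /=.
by rewrite mulrN opprK !expr2.
Qed.

Lemma rdot_cauchy_schwarz N (x y : 'cV[C]_N) : rdot x y ^+ 2 <= l2sum x * l2sum y.
Proof.
have key s t : 0 <= s ^+ 2 * l2sum x - 2 * s * t * rdot x y + t ^+ 2 * l2sum y.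
  have -> : s ^+ 2 * l2sum x - 2 * s * t * rdot x y + t ^+ 2 * l2sum y =
    \sum_i ((s * complex.Re (x i ord0) - t * complex.Re (y i ord0)) ^+ 2 +
            (s * complex.Im (x i ord0) - t * complex.Im (y i ord0)) ^+ 2).
    rewrite /l2sum /rdot !mulr_sumr -sumrB -big_split /=; apply: eq_bigr => i _.
    by rewrite !normc_sqr; case: (x i _) (y i _) => a b [c d] /=; ring.
  by apply: sumr_ge0 => i _; rewrite addr_ge0 // sqr_ge0.
have := l2sum_ge0 y; rewrite le_eqVlt => /predU1P[y0|y0]; last first.
  (* With these weights the quadratic form factors through [l2sum y]. *)
  have := key (l2sum y) (rdot x y).
  rewrite [X in 0 <= X](_ : _ = l2sum y * (l2sum x * l2sum y - rdot x y ^+ 2)); last by ring.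
  by rewrite pmulr_rge0 // subr_ge0.
have y00 i : y i ord0 = 0.
  apply/eq0_normc/eqP; rewrite -sqrf_eq0.
  have /esym/eqP := y0; rewrite psumr_eq0 => [/allP/(_ i)|? _]; last exact: sqr_ge0.
  by rewrite mem_index_enum /= => /(_ isT).
rewrite -y0 mulr0 /rdot big1 ?expr0n // => i _.
by rewrite y00; case: (x i _) => a b /=; rewrite !(oppr0, mulr0, subr0).
Qed.

Definition adjmx N (A : 'M[C]_N) : 'M[C]_N := (map_mx (@conjc R) A)^T.

Lemma rdot_adjmx N (A : 'M[C]_N) x y : rdot (adjmx A *m x) y = rdot x (A *m y).
Proof.
rewrite /rdot.
transitivity (\sum_i \sum_j complex.Re (conjc (A j i) * x j ord0 * conjc (y i ord0))).
  by apply: eq_bigr => i _; rewrite mxE mulr_suml raddf_sum; apply: eq_bigr => j _; rewrite !mxE.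
rewrite exchange_big; apply: eq_bigr => j _ /=.
rewrite mxE rmorph_sum mulr_sumr raddf_sum; apply: eq_bigr => i _ /=.
by rewrite rmorphM mulrA [X in _ = complex.Re (X * _)]mulrC.
Qed.

Definition persymmetric N (A : 'M[C]_N) : Prop :=
  forall i j, A (rev_ord i) (rev_ord j) = A j i.

Definition reflect_conj N (u : 'cV[C]_N) : 'cV[C]_N :=
  \col_i conjc (u (rev_ord i) ord0).

Lemma adjmx_reflect N (A : 'M[C]_N) u : persymmetric A ->
  adjmx A *m u = reflect_conj (A *m reflect_conj u).
Proof.
move=> HA; apply/matrixP => i k; rewrite ord1 !mxE rmorph_sum.
rewrite (reindex_inj rev_ord_inj) /=; apply: eq_bigr => j _.
by rewrite !mxE -HA !rev_ordK rmorphM /= conjcK.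
Qed.

Lemma fmodular_reflect f N (u : 'cV[C]_N) mu :
  fmodular f (reflect_conj u) mu = fmodular f u mu.
Proof.
rewrite /fmodular [RHS](reindex_inj rev_ord_inj) /=; apply: eq_bigr => j _.
by rewrite mxE normc_conj.
Qed.

Lemma modular_bounded_adjmx f c N (A : 'M[C]_N) : persymmetric A ->
  modular_bounded f c A -> modular_bounded f c (adjmx A).
Proof.
move=> HA bA u mu mu0 Hu; rewrite adjmx_reflect // fmodular_reflect.
by apply: bA => //; rewrite fmodular_reflect.
Qed.

Lemma fmodular_entry_le f g N (u : 'cV[C]_N) mu i : halfline_iso f g ->
  0 < mu -> fmodular f u mu <= 1 -> normc (u i ord0) <= g 1 * mu.
Proof.
move=> H mu0 Hu; rewrite -ler_pdivrMr //.
have z0 : 0 <= normc (u i ord0) / mu by rewrite divr_ge0 ?normc_ge0 ?(ltW mu0).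
rewrite -(iso_le H) ?(iso_inv_ge0 H) // (iso_invK H) //.
apply: le_trans Hu; rewrite /fmodular (bigD1 i) //= lerDl.
by apply: sumr_ge0 => j _; apply: (iso_ge0 H); rewrite divr_ge0 ?normc_ge0 ?(ltW mu0).
Qed.

Lemma fmodular_le1_exists f g N (u : 'cV[C]_N) : halfline_iso f g ->
  exists2 mu, 0 < mu & fmodular f u mu <= 1.
Proof.
move=> H; have gp : 0 < g N.+1%:R^-1 by apply: (iso_gt0 (halfline_iso_sym H)); rewrite invr_gt0.
pose S := 1 + \sum_i normc (u i ord0).
have S0 : 0 < S by rewrite ltr_pwDl // sumr_ge0 // => i _; exact: normc_ge0.
have m0 : 0 < S / g N.+1%:R^-1 by rewrite divr_gt0.
(* At this scale each of the [N] terms is at most 1/(N+1); using N + 1 also covers the empty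
   vector. *)
exists (S / g N.+1%:R^-1) => //.
apply: (@le_trans _ _ (\sum_(i < N) N.+1%:R^-1)).
  apply: ler_sum => i _.
  rewrite -[leRHS](iso_invK H) ?invr_ge0 ?ler0n // (iso_le H) ?(ltW gp) //; last first.
    by rewrite divr_ge0 ?normc_ge0 ?(ltW m0).
  rewrite ler_pdivrMr // mulrCA divff ?gt_eqF // mulr1 /S (bigD1 i) //=.
  have : 0 <= \sum_(j < N | j != i) normc (u j ord0).
    by apply: sumr_ge0 => j _; exact: normc_ge0.
  lra.
rewrite sumr_const card_ord -[_ *+ N]mulr_natl ler_pdivrMr ?ltr0n // mul1r ler_nat.
exact: leqnSn.
Qed.

Lemma bernoulli_le (q : R) n : 1 <= q -> 1 + n%:R * (q - 1) <= q ^+ n.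
Proof.
move=> q1; elim: n => [|n IH]; first by rewrite mul0r addr0 expr0.
rewrite exprS -natr1; have q0 : 0 <= q by lra.
apply: le_trans (ler_wpM2l q0 IH).
have : 0 <= n%:R * (q - 1) * (q - 1) by rewrite !mulr_ge0 // subr_ge0.
lra.
Qed.

(* The moments <(A*A)^m u, u> are log-convex along powers of 2, while any
   bound on A and A* for another norm makes them grow at most like c^(2m):
   the constant comparing that norm with l^2 disappears in the limit. *)
Lemma persymmetric_l2_bound f g c N (A : 'M[C]_N) u :
  halfline_iso f g -> 0 < c -> persymmetric A -> modular_bounded f c A ->
  l2sum (A *m u) <= c ^+ 2 * l2sum u.
Proof.
move=> H c0 HA bA.
pose B (x : 'cV[C]_N) := adjmx A *m (A *m x).
have rdotB x y : rdot (B x) y = rdot x (B y).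
  by rewrite /B rdot_adjmx [RHS]rdotC rdot_adjmx rdotC.
have rdot_iter m x y : rdot (iter m B x) y = rdot x (iter m B y).
  by elim: m x y => // m IH x y; rewrite iterS rdotB IH -iterSr.
pose M m := rdot (iter m B u) u.
have M2 m : M (m + m)%N = l2sum (iter m B u).
  by rewrite /M iterD rdot_iter rdot_self.
have M0 : M 0%N = l2sum u by rewrite -rdot_self.
have M1 : M 1%N = l2sum (A *m u) by rewrite /M /= rdot_adjmx rdot_self.
have [mu mu0 Hmu] := fmodular_le1_exists u H.
have Biter m : fmodular f (iter m B u) ((c ^+ 2) ^+ m * mu) <= 1.
  elim: m => [|m IH]; first by rewrite expr0 mul1r.
  rewrite iterS [_ ^+ m.+1]exprS expr2 -!mulrA; rewrite expr2 in IH.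
  apply: modular_bounded_adjmx => //.
    by rewrite !mulr_gt0 ?exprn_gt0 // mulr_gt0.
  by apply: bA => //; rewrite !mulr_gt0 ?exprn_gt0 // mulr_gt0.
have c20 : 0 < c ^+ 2 by rewrite exprn_gt0.
pose K := N%:R * (g 1 * mu) ^+ 2.
(* The squared l^2 norm of the m-th iterate is a sum of [N] squares of entries, each entry at most
   [g 1] times the scale; the dimension enters only through [K]. *)
have Mle m : M (m + m)%N <= K * (c ^+ 2) ^+ (m + m).
  rewrite M2; apply: (@le_trans _ _ (\sum_(i < N) (g 1 * ((c ^+ 2) ^+ m * mu)) ^+ 2)).
    apply: ler_sum => i _; rewrite lerXn2r ?nnegrE ?normc_ge0 //.
      by rewrite !mulr_ge0 ?exprn_ge0 ?(ltW mu0) ?(ltW c0) // (iso_inv_ge0 H).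
    by apply: (fmodular_entry_le i H _ (Biter m)); rewrite mulr_gt0 ?exprn_gt0.
  rewrite sumr_const card_ord -[_ *+ N]mulr_natl /K exprD le_eqVlt; apply/orP; left.
  by apply/eqP; ring.
have := l2sum_ge0 u; rewrite le_eqVlt => /predU1P[u0|u0].
  have u00 : l2sum (A *m u) ^+ 2 <= 0.
    rewrite -M1 (le_trans (rdot_cauchy_schwarz _ _)) // -u0 mulr0 //.
  have : l2sum (A *m u) ^+ 2 == 0 by rewrite eq_le u00 sqr_ge0.
  by rewrite -u0 mulr0 sqrf_eq0 => /eqP ->.
rewrite -ler_pdivrMr // leNgt; apply/negP => r2.
pose q := l2sum (A *m u) / l2sum u / c ^+ 2.
have q1 : 1 < q by rewrite ltr_pdivlMr // mul1r.
have q0 : 0 < q := lt_trans ltr01 q1.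
(* Cauchy-Schwarz gives M(n)^2 <= M(2n) M(0), so M(n) / M(0) is at least squared when n doubles. *)
have lower k : (q * c ^+ 2) ^+ (2 ^ k) * l2sum u <= M (2 ^ k)%N.
  rewrite /q divfK ?gt_eqF //.
  elim: k => [|k IH]; first by rewrite expn0 expr1 divfK ?gt_eqF // M1.
  rewrite expnS mul2n -addnn exprD.
  have := rdot_cauchy_schwarz (iter (2 ^ k) B u) u; rewrite -/(M _) -M2 => CS.
  rewrite -(ler_pM2r u0); apply: le_trans CS.
  have : 0 <= (l2sum (A *m u) / l2sum u) ^+ (2 ^ k).
    by rewrite exprn_ge0 // divr_ge0 // l2sum_ge0.
  move: IH; set X := _ ^+ (2 ^ k) => IH X1.
  have X0 : 0 <= X * l2sum u by rewrite mulr_ge0 // ltW.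
  rewrite [leLHS](_ : _ = (X * l2sum u) ^+ 2); last by ring.
  by rewrite lerXn2r ?nnegrE // (le_trans X0).
(* The two bounds at the exponent 2^(k+1) keep a power of q > 1 bounded for all [k]; Bernoulli's
   inequality makes this a linear bound, false for large [k]. *)
have bnd k : k%:R * (q - 1) <= K / l2sum u.
  have e2 : (2 ^ k + 2 ^ k = 2 ^ k.+1)%N by rewrite addnn expnS mul2n.
  have := Mle (2 ^ k)%N; rewrite e2 => /(le_trans (lower k.+1)).
  rewrite exprMn mulrAC ler_pM2r ?exprn_gt0 // -ler_pdivlMr //.
  apply: le_trans; apply: le_trans (bernoulli_le _ (ltW q1)).
  rewrite -[leLHS]add0r lerD // ler_pM2r ?subr_gt0 // ler_nat.
  by apply: ltnW; apply: leq_trans (ltn_expl k.+1 (isT : 1 < 2)%N).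
pose k := (Num.truncn (K / l2sum u / (q - 1))).+1.
have := bnd k; rewrite -ler_pdivlMr ?subr_gt0 //.
rewrite leNgt => /negP; apply.
exact: truncnS_gt.
Qed.

End FiniteModular.

(** * Interpolation *)

Section Interpolation.
Variable R : realType.
Local Notation C := R[i].
Local Open Scope complex_scope.

Lemma normc_real (x : R) : normc x%:C = `|x|.
Proof. by rewrite /normc /= expr0n /= addr0 sqrtr_sqr. Qed.

Lemma normc_sum (I : Type) (s : seq I) (P : pred I) (F : I -> C) :
  normc (\sum_(i <- s | P i) F i) <= \sum_(i <- s | P i) normc (F i).
Proof.
elim/big_ind2: _ => [|x a y b xa yb|//]; first by rewrite normc0.
exact: le_trans (le_normcD _ _) (lerD xa yb).
Qed.

Lemma normc_sign (b : bool) : normc ((-1) ^+ b : C) = 1.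
Proof. by case: b; rewrite ?expr1 ?expr0 ?normcN normc1. Qed.

(* Flipping every sign but the [i]-th isolates [2 v i]. *)
Lemma normc_le_sign_average m (v : 'I_m -> C) i :
  normc (v i) <= #|{ffun 'I_m -> bool}|%:R^-1 *
    \sum_(e : {ffun 'I_m -> bool}) normc (\sum_j (-1) ^+ e j * v j).
Proof.
pose T : finType := {ffun 'I_m -> bool}; rewrite -[X in X%:R^-1]/(#|T|).
have T0 : 0 < #|T|%:R :> R by rewrite ltr0n; apply/card_gt0P; exists [ffun=> true].
pose S (e : T) := \sum_j (-1) ^+ e j * v j.
pose flip (e : T) : T := [ffun j => if j == i then e j else ~~ e j].
have flipK : involutive flip.
  by move=> e; apply/ffunP => j; rewrite !ffunE; case: eqP => // _; rewrite negbK.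
rewrite mulrC ler_pdivlMr //.
have : \sum_e normc (S e) + \sum_e normc (S e) >= 2 * (normc (v i) * #|T|%:R).
  rewrite [X in _ <= _ + X](reindex_inj (inv_inj flipK)) /= -big_split /=.
  apply: (@le_trans _ _ (\sum_(e : T) 2 * normc (v i))).
    by rewrite sumr_const mulrA mulr_natr.
  apply: ler_sum => e _; apply: le_trans (le_normcD _ _).
  have -> : S e + S (flip e) = 2%:R * ((-1) ^+ e i * v i).
    rewrite /S -big_split /= (bigD1 i) //= big1 => [|j ji].
      by rewrite ffunE eqxx addr0 mulr_natl mulr2n.
    by rewrite ffunE (negbTE ji) signrN mulNr subrr.
  by rewrite !normcM normc_sign mul1r -(rmorph_nat (real_complex R)) normc_real normr_nat.
by rewrite /S /T; lra.
Qed.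

(** [H] is the average over all signs of the moduli of the entries, divided by [nu]. Jensen keeps
    its modular at most 1, and the sign average dominates each single weighted piece. *)
Lemma averaged_bound (phi : R -> R) m N (w : 'I_m -> R) (U : 'I_m -> 'cV[C]_N)
    (A : 'M[C]_N) nu :
  convex_function halfline phi -> (forall i, 0 <= w i) -> 0 < nu ->
  (forall e : {ffun 'I_m -> bool},
    fmodular phi (A *m \sum_i ((-1) ^+ e i * (w i)%:C) *: U i) nu <= 1) ->
  exists H : 'I_N -> R, [/\ forall n, 0 <= H n, \sum_n phi (H n) <= 1 &
    forall i n, w i * normc ((A *m U i) n ord0) <= nu * H n].
Proof.
move=> cphi w0 nu0 Hb; pose T : finType := {ffun 'I_m -> bool}.
have T0 : (0 < #|T|)%N by apply/card_gt0P; exists [ffun=> true].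
have T0' : 0 < #|T|%:R :> R by rewrite ltr0n.
have E (e : T) n : (A *m \sum_i ((-1) ^+ e i * (w i)%:C) *: U i) n ord0 =
    \sum_i (-1) ^+ e i * ((w i)%:C * (A *m U i) n ord0).
  rewrite mulmx_sumr summxE; apply: eq_bigr => i _.
  by rewrite -scalemxAr mxE mulrA.
pose X (e : T) n := normc ((A *m \sum_i ((-1) ^+ e i * (w i)%:C) *: U i) n ord0) / nu.
have X0 e n : 0 <= X e n by rewrite divr_ge0 ?normc_ge0 // ltW.
exists (fun n => #|T|%:R^-1 * \sum_e X e n); split.
- by move=> n; rewrite mulr_ge0 ?invr_ge0 ?(ltW T0') // sumr_ge0.
- apply: (@le_trans _ _ (\sum_n #|T|%:R^-1 * \sum_e phi (X e n))).
    by apply: ler_sum => n _; apply: jensen_average => // e; exact: X0.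
  rewrite -mulr_sumr exchange_big /= mulrC ler_pdivrMr // mul1r.
  apply: (@le_trans _ _ (\sum_(e : T) 1)); first by apply: ler_sum => e _; exact: Hb.
  by rewrite sumr_const.
- move=> i n.
  have -> : w i * normc ((A *m U i) n ord0) = normc ((w i)%:C * (A *m U i) n ord0).
    by rewrite normcM normc_real ger0_norm.
  apply: le_trans (normc_le_sign_average (fun j => (w j)%:C * (A *m U j) n ord0) i) _.
  rewrite mulrCA ler_wpM2l ?invr_ge0 ?(ltW T0') // mulr_sumr ler_sum // => e _.
  by rewrite /X mulrC divfK ?gt_eqF // E.
Qed.

(** The terms increase, so the sum is controlled by the last one kept, which is at most [y], times r
    / (r - 1). *)
Lemma truncated_geometric_sum (r y p : R) m : 1 < r -> 0 <= p -> 0 <= y ->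
  \sum_(i < m) (if p * r ^+ i <= y then p * r ^+ i else 0) <= y * (r / (r - 1)).
Proof.
move=> r1 p0 y0.
have r0 : 0 <= r by lra.
have r10 : 0 < r - 1 by lra.
have full k : \sum_(i < k) p * r ^+ i <= p * r ^+ k / (r - 1).
  elim: k => [|k IH]; first by rewrite big_ord0 divr_ge0 ?mulr_ge0 ?exprn_ge0 // ltW.
  rewrite big_ord_recr /=; apply: le_trans (lerD IH (lexx _)) _.
  rewrite le_eqVlt; apply/orP; left; apply/eqP; rewrite exprS; field.
  by rewrite gt_eqF.
elim: m => [|m IH]; first by rewrite big_ord0 mulr_ge0 // divr_ge0 // ltW.
rewrite big_ord_recr /=; case: ifP => [py|_]; last by rewrite addr0.
apply: (@le_trans _ _ (\sum_(i < m.+1) p * r ^+ i)).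
  rewrite big_ord_recr /= lerD2r; apply: ler_sum => i _; case: ifP => // _.
  by rewrite mulr_ge0 ?exprn_ge0.
apply: le_trans (full _) _.
have -> : p * r ^+ m.+1 / (r - 1) = p * r ^+ m * (r / (r - 1)) by rewrite exprS; ring.
rewrite ler_wpM2r //.
by rewrite divr_ge0 // ltW.
Qed.

(** Summing in reverse order gives an increasing progression that starts at the former last term. *)
Lemma truncated_geometric_sum_rev (r y p : R) m : 1 < r -> 0 <= p -> 0 <= y ->
  \sum_(i < m) (if p * r ^- i <= y then p * r ^- i else 0) <= y * (r / (r - 1)).
Proof.
move=> r1 p0 y0; have r0 : 0 < r by lra.
case: m => [|m].
  by rewrite big_ord0 mulr_ge0 // divr_ge0 ?(ltW r0) // subr_ge0 ltW.
have q0 : 0 <= p * r ^- m by rewrite divr_ge0 // exprn_ge0 // ltW.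
apply: le_trans (truncated_geometric_sum m.+1 r1 q0 y0).
rewrite (reindex_inj rev_ord_inj) /= le_eqVlt; apply/orP; left; apply/eqP.
apply: eq_bigr => i _; rewrite subSS.
have im : (i <= m)%N by rewrite -ltnS.
have -> : r ^- (m - i) = r ^- m * r ^+ i; last by rewrite mulrA.
by rewrite expfB_cond ?gt_eqF // invf_div mulrC.
Qed.

Lemma dyadic_levels N (x : 'I_N -> R) : (forall n, 0 < x n) ->
  exists tau m (lev : 'I_N -> 'I_m.+1), 0 < tau /\
    forall n, tau * 2 ^+ lev n <= x n < 2 * (tau * 2 ^+ lev n).
Proof.
move=> x0; pose S := 1 + \sum_n (x n)^-1.
have S0 : 0 < S by rewrite ltr_pwDl // sumr_ge0 // => n _; rewrite invr_ge0 ltW.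
have Sx n : 1 <= x n * S.
  rewrite -[leLHS](divff (lt0r_neq0 (x0 n))) ler_pM2l // /S (bigD1 n) //=.
  have : 0 <= \sum_(j < N | j != n) (x j)^-1.
    by apply: sumr_ge0 => j _; rewrite invr_ge0 ltW.
  by lra.
(* The choice of [S] makes [x n * S] at least 1. Taking the integer part first is harmless, since
   powers of 2 are integers. *)
pose k n := trunc_log 2 (Num.truncn (x n * S)).
have kb n : 2 ^+ k n <= x n * S < 2 * 2 ^+ k n.
  have xS0 : 0 <= x n * S := le_trans ler01 (Sx n).
  have /andP[t1 t2] := truncn_itv xS0.
  have tp : (0 < Num.truncn (x n * S))%N.
    by rewrite truncn_gt0.
  have /andP[l1 l2] := trunc_log_bounds (isT : (1 < 2)%N) tp.
  apply/andP; split.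
    by apply: le_trans t1; rewrite -natrX ler_nat.
  apply: lt_le_trans t2 _; rewrite -exprS -natrX ler_nat //.
exists S^-1, (\sum_n k n)%N, (fun n => inord (k n)); split; first by rewrite invr_gt0.
move=> n; have kn : (k n < (\sum_n k n).+1)%N by rewrite ltnS (bigD1 n) //= leq_addr.
rewrite inordK //; have /andP[k1 k2] := kb n.
rewrite [S^-1 * _]mulrC ler_pdivrMr // k1 /= mulrA ltr_pdivlMr //.
Qed.

(** The two majorants p_i and q_i satisfy p_i^(1-theta) q_i^theta = a^(1-theta) b^theta for every i,
    so one of them is at most this value [y]. Bounding z_i by that one leaves two truncated
    geometric sums. *)
Lemma min_geometric_sum (theta tau a b : R) m (z : 'I_m -> R) :
  0 < theta < 1 -> 0 < tau -> 0 <= a -> 0 <= b ->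
  (forall i, z i <= (tau * 2 ^+ i) `^ theta * a) ->
  (forall i, z i <= (tau * 2 ^+ i) `^ (theta - 1) * b) ->
  \sum_i z i <= (2 `^ theta / (2 `^ theta - 1) +
                 2 `^ (1 - theta) / (2 `^ (1 - theta) - 1)) *
                (a `^ (1 - theta) * b `^ theta).
Proof.
move=> /andP[th0 th1] tau0 a0 b0 za zb.
set y := a `^ (1 - theta) * b `^ theta.
have y0 : 0 <= y by rewrite mulr_ge0 ?powR_ge0.
have W0 (i : nat) : 0 < tau * 2 ^+ i by rewrite mulr_gt0 // exprn_gt0.
have pow2 (s : R) (i : nat) : (tau * 2 ^+ i) `^ s = tau `^ s * (2 `^ s) ^+ i.
  rewrite powRM ?(ltW tau0) ?exprn_ge0 // -powR_mulrn // -powRrM [_ * s]mulrC powRrM.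
  by rewrite powR_mulrn // powR_ge0.
have two_gt1 (s : R) : 0 < s -> 1 < 2 `^ s :> R.
  move=> s0; rewrite -[ltLHS](congr1 (fun h => h s) (@powR1 R)) gt0_ltr_powR ?nnegrE ?ltr1n //.
pose p i := tau `^ theta * a * (2 `^ theta) ^+ i.
pose q i := tau `^ (theta - 1) * b * (2 `^ (1 - theta)) ^- i.
have pE i : p i = (tau * 2 ^+ i) `^ theta * a by rewrite /p mulrAC -pow2.
have qE i : q i = (tau * 2 ^+ i) `^ (theta - 1) * b.
  by rewrite /q mulrAC -exprVn -powRN opprB -pow2.
have zp (i : 'I_m) : z i <= p i by rewrite pE.
have zq (i : 'I_m) : z i <= q i by rewrite qE.
have pq i : p i `^ (1 - theta) * q i `^ theta = y.
  rewrite pE qE.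
  rewrite (powRM _ (powR_ge0 _ _) a0) (powRM _ (powR_ge0 _ _) b0) -!powRrM mulrACA -powRD.
    by rewrite [X in _ `^ X](_ : _ = 0) ?powRr0 ?mul1r //; ring.
  by rewrite (gt_eqF (W0 i)) implybT.
have p0 i : 0 <= p i by rewrite !mulr_ge0 ?exprn_ge0 ?powR_ge0.
have q0 i : 0 <= q i.
  by rewrite /q divr_ge0 ?exprn_ge0 ?mulr_ge0 ?powR_ge0.
apply: (@le_trans _ _ (\sum_(i < m) ((if p i <= y then p i else 0) +
                                     (if q i <= y then q i else 0)))).
  apply: ler_sum => i _.
  have [py|yp] := leP (p i) y.
    by apply: le_trans (zp i) _; rewrite lerDl; case: ifP.
  have [qy|yq] := leP (q i) y; first by rewrite add0r.
  suff : y < y by rewrite ltxx.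
  have lt1 : y `^ (1 - theta) < p i `^ (1 - theta).
    by rewrite gt0_ltr_powR ?nnegrE // subr_gt0.
  have lt2 : y `^ theta < q i `^ theta by rewrite gt0_ltr_powR ?nnegrE.
  rewrite -[ltRHS](pq i); apply: le_lt_trans (ltr_pM _ _ lt1 lt2); rewrite ?powR_ge0 //.
  by rewrite -powRD subrK ?oner_eq0 // powRr1.
rewrite big_split /= mulrC mulrDr; apply: lerD.
  by apply: truncated_geometric_sum; rewrite ?two_gt1 ?mulr_ge0 ?powR_ge0.
by apply: truncated_geometric_sum_rev; rewrite ?two_gt1 ?subr_gt0 ?mulr_ge0 ?powR_ge0.
Qed.

Lemma convex_sqr : convex_function halfline (fun x : R => x ^+ 2).
Proof.
apply: (convex_halflineP (fun x : R => x ^+ 2)).2 => t x y /andP[t0 t1] _ _.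
rewrite -subr_ge0 [X in 0 <= X](_ : _ = t * (1 - t) * (x - y) ^+ 2); last by ring.
by rewrite mulr_ge0 ?sqr_ge0 // mulr_ge0 // subr_ge0.
Qed.

Section Bound.
Variables (f0 g0 f g : R -> R) (theta K c : R).
Hypothesis iso_f0 : halfline_iso f0 g0.
Hypothesis iso_f : halfline_iso f g.
Hypothesis convex_f0 : convex_function halfline f0.
Hypothesis convex_f : convex_function halfline f.
Hypothesis theta01 : 0 < theta < 1.
Hypothesis K_gt0 : 0 < K.
Hypothesis c_gt0 : 0 < c.
Hypothesis g_le : forall t, 0 <= t -> g t <= g0 t `^ (1 - theta) * t `^ (theta / 2).
Hypothesis g_ge : forall t, 0 <= t -> g0 t `^ (1 - theta) * t `^ (theta / 2) <= K * g t.

(** The factor 4 is 2 from the width of the dyadic levels times 2 from adding two modulars; the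
    geometric series and [K] account for the rest. *)
Definition interpolation_constant : R :=
  (4 * (2 `^ theta / (2 `^ theta - 1) + 2 `^ (1 - theta) / (2 `^ (1 - theta) - 1))
   * K) * c.

Let S := 2 `^ theta / (2 `^ theta - 1) + 2 `^ (1 - theta) / (2 `^ (1 - theta) - 1) : R.

Let S_gt0 : 0 < S.
Proof.
have /andP[th0 th1] := theta01.
have two_gt1 (s : R) : 0 < s -> 0 < 2 `^ s / (2 `^ s - 1) :> R.
  move=> s0; have h : 1 < 2 `^ s :> R.
    by rewrite -[ltLHS](congr1 (fun h => h s) (@powR1 R)) gt0_ltr_powR ?nnegrE ?ltr1n.
  by rewrite divr_gt0 ?subr_gt0 // (lt_trans ltr01).
by rewrite addr_gt0 // two_gt1 // subr_gt0.
Qed.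

Lemma interpolation_constant_gt0 : 0 < interpolation_constant.
Proof. by rewrite /interpolation_constant !mulr_gt0. Qed.

Lemma interpolation N (A : 'M[C]_N) : modular_bounded f0 c A ->
  (forall u, l2sum (A *m u) <= c ^+ 2 * l2sum u) ->
  modular_bounded f interpolation_constant A.
Proof.
move=> bA A2 u mu mu0 Hu.
have /andP[th0 th1] := theta01.
have th1' : 0 < 1 - theta by rewrite subr_gt0.
pose s n := f (normc (u n ord0) / mu).
have xn0 n : 0 <= normc (u n ord0) / mu by rewrite divr_ge0 ?normc_ge0 // ltW.
have s0 n : 0 <= s n by apply: (iso_ge0 iso_f).
have g0s n : 0 <= g0 (s n) by apply: (iso_inv_ge0 iso_f0).
have half_pow (t : R) : 0 <= t -> (t `^ 2^-1) `^ theta = t `^ (theta / 2).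
  by move=> t0; rewrite -powRrM mulrC.
(* Where [s n] is 0 the entry of [u] vanishes; the value 1 there only keeps [x] positive. *)
pose x n := if s n == 0 then 1 else s n `^ 2^-1 / g0 (s n).
have x0 n : 0 < x n.
  rewrite /x; case: eqVneq => // sn.
  have sp : 0 < s n by rewrite lt_neqAle eq_sym sn s0.
  by rewrite divr_gt0 ?powR_gt0 // (iso_gt0 (halfline_iso_sym iso_f0)).
have [tau [m [lev [tau0 levP]]]] := dyadic_levels x0.
pose W (i : 'I_m.+1) := tau * 2 ^+ i.
have W0 i : 0 < W i by rewrite mulr_gt0 // exprn_gt0.
pose U (i : 'I_m.+1) : 'cV[C]_N := \col_n (if lev n == i then u n ord0 else 0).
have sumU : \sum_i U i = u.
  apply/matrixP => n j; rewrite ord1 summxE (bigD1 (lev n)) //= mxE eqxx.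
  by rewrite big1 ?addr0 // => i il; rewrite mxE eq_sym (negbTE il).
(* The pieces have disjoint supports, so the signs disappear in absolute value. *)
have entry (w : 'I_m.+1 -> R) (e : {ffun 'I_m.+1 -> bool}) n : (forall i, 0 <= w i) ->
    normc ((\sum_i ((-1) ^+ e i * (w i)%:C) *: U i) n ord0) =
    w (lev n) * normc (u n ord0).
  move=> w0; rewrite summxE (bigD1 (lev n)) //= big1 ?addr0.
    by rewrite !mxE eqxx !normcM normc_sign mul1r normc_real ger0_norm.
  by move=> i il; rewrite !mxE eq_sym (negbTE il) mulr0.
have ule n : normc (u n ord0) / mu <= g0 (s n) `^ (1 - theta) * (s n `^ 2^-1) `^ theta.
  by rewrite half_pow //; apply: le_trans (g_le (s0 n)); rewrite /s (isoK iso_f).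
have zero n : s n = 0 -> normc (u n ord0) = 0.
  move=> sn; have : g (s n) = 0 by rewrite sn (iso0 (halfline_iso_sym iso_f)).
  rewrite /s (isoK iso_f) // => /eqP; rewrite mulf_eq0 invr_eq0 [mu == 0]gt_eqF // orbF.
  by move/eqP.
have levs n : s n != 0 -> W (lev n) * g0 (s n) <= s n `^ 2^-1 <= 2 * (W (lev n) * g0 (s n)).
  move=> sn; have sp : 0 < s n by rewrite lt_neqAle eq_sym sn s0.
  have gp : 0 < g0 (s n) by apply: (iso_gt0 (halfline_iso_sym iso_f0)).
  have := levP n; rewrite /x (negbTE sn) ler_pdivlMr // ltr_pdivrMr //.
  by rewrite /W -!mulrA => /andP[-> /ltW ->].
(* The upper level bound s^(1/2) <= 2 W g0(s) gives W^(-theta) |u| / mu <= 2 g0(s), using 2^theta <=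
   2; hence the scale 2 mu. *)
have [H0 [H00 H01 H0b]] : exists H : 'I_N -> R,
    [/\ forall n, 0 <= H n, \sum_n f0 (H n) <= 1 &
    forall i n, W i `^ (- theta) * normc ((A *m U i) n ord0) <= (c * (2 * mu)) * H n].
  apply: averaged_bound => //; [by move=> i; exact: powR_ge0|by rewrite !mulr_gt0|].
  move=> e; apply: bA; first by rewrite mulr_gt0.
  apply: le_trans Hu; apply: ler_sum => n _; rewrite -/(s n).
  rewrite -[leRHS](iso_invK iso_f0) // (iso_le iso_f0) //; last first.
    by rewrite divr_ge0 ?normc_ge0 // ltW // mulr_gt0.
  rewrite entry => [|i]; last exact: powR_ge0.
  have [sn|sn] := eqVneq (s n) 0; first by rewrite (zero _ sn) mulr0 mul0r.
  have /andP[_ l2] := levs n sn.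
  rewrite [X in X <= _](_ : _ =
    (W (lev n) `^ (- theta) * (normc (u n ord0) / mu)) / 2); last first.
    by field; rewrite gt_eqF.
  rewrite ler_pdivrMr // powRN mulrC ler_pdivrMr ?powR_gt0 //.
  apply: le_trans (ule n) _.
  apply: (@le_trans _ _ (g0 (s n) `^ (1 - theta) * (2 * (W (lev n) * g0 (s n))) `^ theta)).
    rewrite ler_wpM2l ?powR_ge0 // ge0_ler_powR ?nnegrE ?powR_ge0 ?(ltW th0) //.
    by rewrite !mulr_ge0 // ltW.
  rewrite (powRM _ (ler0n _ 2) (mulr_ge0 (ltW (W0 _)) (g0s n))) (powRM _ (ltW (W0 _)) (g0s n)).
  rewrite [leLHS](_ : _ = 2 `^ theta *
    (g0 (s n) `^ (1 - theta) * g0 (s n) `^ theta) * W (lev n) `^ theta); last by ring.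
  rewrite ler_wpM2r ?powR_ge0 // -powRD subrK ?oner_eq0 // powRr1 // mulrC.
  by rewrite ler_wpM2l // ler1_powR ?ler1n // ltW.
(* The lower level bound W g0(s) <= s^(1/2) gives W^(1-theta) |u| / mu <= s^(1/2), without loss. *)
have [H1 [H10 H11 H1b]] : exists H : 'I_N -> R,
    [/\ forall n, 0 <= H n, \sum_n (H n) ^+ 2 <= 1 &
    forall i n, W i `^ (1 - theta) * normc ((A *m U i) n ord0) <= (c * mu) * H n].
  apply: (@averaged_bound (fun x => x ^+ 2)) => //.
  - exact: convex_sqr.
  - by move=> i; exact: powR_ge0.
  - by rewrite !mulr_gt0.
  have sqE v nu : fmodular (fun x => x ^+ 2) v nu = l2sum v / nu ^+ 2 :> R.
    by rewrite /fmodular /l2sum mulr_suml; apply: eq_bigr => n _; rewrite exprMn exprVn.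
  move=> e; rewrite sqE ler_pdivrMr ?exprn_gt0 ?mulr_gt0 // mul1r exprMn.
  apply: le_trans (A2 _) _; rewrite ler_wpM2l ?exprn_ge0 ?(ltW c_gt0) //.
  rewrite -[leRHS]mul1r -ler_pdivrMr ?exprn_gt0 // -sqE.
  apply: le_trans Hu; apply: ler_sum => n _; rewrite -/(s n).
  rewrite entry => [|i]; last exact: powR_ge0.
  have [sn|sn] := eqVneq (s n) 0; first by rewrite (zero _ sn) mulr0 mul0r expr0n /= s0.
  have /andP[l1 _] := levs n sn.
  have -> : s n = (s n `^ 2^-1) ^+ 2.
    by rewrite -powR_mulrn ?powR_ge0 // -powRrM mulVf ?pnatr_eq0 // powRr1.
  rewrite lerXn2r ?nnegrE ?powR_ge0 //.
    by rewrite -mulrA mulr_ge0 ?powR_ge0.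
  rewrite -mulrA; apply: le_trans (ler_wpM2l (powR_ge0 _ _) (ule n)) _.
  rewrite mulrA -powRM ?(ltW (W0 _)) //.
  apply: (@le_trans _ _ ((s n `^ 2^-1) `^ (1 - theta) * (s n `^ 2^-1) `^ theta)).
    rewrite ler_wpM2r ?powR_ge0 // ge0_ler_powR ?nnegrE ?powR_ge0 ?(ltW th1') //.
    by rewrite mulr_ge0 // ltW.
  by rewrite -powRD subrK ?oner_eq0 // powRr1 ?powR_ge0.
(* [h] dominates both modular densities: H0 <= g0(h) and H1 <= h^(1/2), so H0^(1-theta) H1^theta <=
   K g(h) by [g_ge]. *)
pose h n := f0 (H0 n) + H1 n ^+ 2.
have h0 n : 0 <= h n by rewrite addr_ge0 ?sqr_ge0 // (iso_ge0 iso_f0).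
have hs : \sum_n h n <= 2 by rewrite big_split /= (_ : 2 = 1 + 1) // lerD.
have gh0 n : 0 <= g (h n) by apply: (iso_inv_ge0 iso_f).
have point n : normc ((A *m u) n ord0) <= 2 * (c * mu) * (S * (K * g (h n))).
  have cm0 : 0 < 2 * (c * mu) by rewrite !mulr_gt0.
  apply: (@le_trans _ _ (2 * (c * mu) * \sum_i (normc ((A *m U i) n ord0) / (2 * (c * mu))))).
    rewrite -mulr_suml mulrC divfK ?gt_eqF //.
    by rewrite -{1}sumU mulmx_sumr summxE; exact: normc_sum.
  rewrite ler_pM2l //.
  apply: le_trans (min_geometric_sum theta01 tau0 (H00 n) (H10 n) _ _) _.
  - move=> i; rewrite -/(W i) ler_pdivrMr //.
    have := H0b i n; rewrite powRN mulrC ler_pdivrMr ?powR_gt0 // => hi.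
    by apply: le_trans hi _; rewrite le_eqVlt; apply/orP; left; apply/eqP; ring.
  - move=> i; rewrite -/(W i) ler_pdivrMr // -opprB powRN.
    have := H1b i n; rewrite mulrC -ler_pdivlMr ?powR_gt0 // => hi.
    apply: le_trans hi _; rewrite -subr_ge0.
    rewrite [X in 0 <= X](_ : _ = c * mu * H1 n / W i `^ (1 - theta)); last by ring.
    by rewrite divr_ge0 ?powR_ge0 // !mulr_ge0 // ltW.
  rewrite -/S ler_pM2l //; apply: le_trans (g_ge (h0 n)).
  apply: ler_pM; rewrite ?powR_ge0 //.
    apply: ge0_ler_powR; rewrite ?nnegrE ?(iso_inv_ge0 iso_f0) ?(ltW th1') //.
    rewrite -[leLHS](isoK iso_f0) // (iso_le (halfline_iso_sym iso_f0)) ?(iso_ge0 iso_f0) //.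
    by rewrite lerDl sqr_ge0.
  rewrite -half_pow //; apply: ge0_ler_powR; rewrite ?nnegrE ?powR_ge0 ?(ltW th0) //.
  have H1E : H1 n = (H1 n ^+ 2) `^ 2^-1.
    by rewrite -powR_mulrn // -powRrM mulfV ?pnatr_eq0 // powRr1.
  rewrite [leLHS]H1E.
  apply: ge0_ler_powR; rewrite ?nnegrE ?exprn_ge0 ?invr_ge0 // lerDr.
  exact: (iso_ge0 iso_f0).
(* The spare factor 2 in the constant passes through the convex [f] and brings the modular from 2
   down to 1. *)
apply: (@le_trans _ _ (\sum_n (2^-1 * h n))).
  apply: ler_sum => n _.
  apply: (@le_trans _ _ (f (2^-1 * g (h n)))).
    have q0 : 0 <= normc ((A *m u) n ord0) / (interpolation_constant * mu).
      by rewrite divr_ge0 ?normc_ge0 // ltW // mulr_gt0 // interpolation_constant_gt0.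
    have q1 : 0 <= 2^-1 * g (h n) by rewrite mulr_ge0 ?invr_ge0.
    rewrite (iso_le iso_f) //.
    rewrite ler_pdivrMr ?mulr_gt0 ?interpolation_constant_gt0 //.
    apply: le_trans (point n) _; rewrite /interpolation_constant -/S.
    by rewrite le_eqVlt; apply/orP; left; apply/eqP; field.
  apply: le_trans (convex_scale_le convex_f (iso0 iso_f) _ (gh0 n)) _.
    by rewrite invr_ge0 ler0n /= invf_le1 // ler1n.
  by rewrite (iso_invK iso_f).
by rewrite -mulr_sumr mulrC ler_pdivrMr // mul1r.
Qed.

End Bound.

End Interpolation.

(** * From finite sections to multipliers *)

Section FiniteSections.
Variable R : realType.
Local Notation C := R[i].
Local Open Scope complex_scope.
Implicit Types (f g Phi : R -> R) (phi : int -> C) (L : nat) (mu nu : R).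

Definition window L : set int := [set k | (absz k <= L)%N].

Definition window_size L := L.*2.+1.

Definition window_int L (i : nat) : int := i%:Z - L%:Z.

Lemma window_intP L (i : 'I_(window_size L)) : window L (window_int L i).
Proof. by rewrite /window /window_int /=; have := ltn_ord i; rewrite /window_size; lia. Qed.

Lemma window_int_bij L : set_bij `I_(window_size L) (window L) (window_int L).
Proof.
split.
- by move=> i /=; rewrite /window /window_int /window_size /=; lia.
- by move=> i j _ _; rewrite /window_int; lia.
- move=> k /=; rewrite /window /= => kL; exists (absz (k + L%:Z)).
    by rewrite /= /window_size; lia.
  by rewrite /window_int; lia.
Qed.

Lemma window_finite L : finite_set (window L).
Proof.
have [_ _ sur] := window_int_bij L.
by apply: sub_finite_set sur _; apply: finite_image; exact: finite_II.
Qed.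

Lemma finite_sub_window (A : set int) : finite_set A -> exists L, A `<=` window L.
Proof.
move=> /finite_seqP [s ->]; exists (\max_(k <- s) absz k)%N => k /= ks.
by rewrite /window /= (big_rem k) //= leq_maxl.
Qed.

Lemma sub_window L L' : (L <= L')%N -> window L `<=` window L'.
Proof. by move=> LL k /= /leq_trans; exact. Qed.

Lemma fsbig_window (T : Type) (idx : T) (op : Monoid.com_law idx) L (F : int -> T) :
  \big[op/idx]_(k \in window L) F k =
  \big[op/idx]_(i < window_size L) F (window_int L i).
Proof.
rewrite (fsbig_ord _ _ (fun i => F (window_int L i))).
exact: reindex_fsbig (window_int_bij L).
Qed.

Definition section L phi : 'cV[C]_(window_size L) := \col_i phi (window_int L i).

Definition extension L (u : 'cV[C]_(window_size L)) (k : int) : C :=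
  if (absz k <= L)%N then u (inord (absz (k + L%:Z))) ord0 else 0.

Lemma section_extension L (u : 'cV[C]_(window_size L)) : section L (extension u) = u.
Proof.
apply/matrixP => i j; rewrite ord1 mxE /extension.
rewrite -/(window L (window_int L i)) ifT; last exact: window_intP.
by rewrite /window_int subrK /= inord_val.
Qed.

Lemma extension_support L (u : 'cV[C]_(window_size L)) k :
  ~ window L k -> extension u k = 0.
Proof. by rewrite /extension /window /= => /negP/negbTE ->. Qed.

Lemma modular_term_ge0 Phi phi mu n : maps_halfline Phi -> 0 < mu ->
  0 <= Phi (normc (phi n / mu%:C)).
Proof. by move=> P0 mu0; apply: P0; exact: normc_ge0. Qed.

Lemma fmodular_section Phi phi mu L : 0 < mu ->
  (\sum_(k \in window L) (Phi (normc (phi k / mu%:C)))%:E)%E =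
  (fmodular Phi (section L phi) mu)%:E.
Proof.
move=> mu0; rewrite fsbig_window sumEFin /fmodular; congr EFin.
apply: eq_bigr => i _; rewrite mxE normcM normcV normc_real gtr0_norm //.
Qed.

Lemma fmodular_section_le Phi phi mu L : maps_halfline Phi -> 0 < mu ->
  ((fmodular Phi (section L phi) mu)%:E <= modular Phi phi mu)%E.
Proof.
move=> P0 mu0; rewrite -fmodular_section //; apply: esum_ge.
by exists (window L) => //; split => //; exact: window_finite.
Qed.

(** Every finite set of integers lies in a large window. The freedom in [L0] lets the windows start
    where they already contain a given support. *)
Lemma modular_le Phi phi mu L0 (b : R) : maps_halfline Phi -> 0 < mu ->
  (forall L, (L0 <= L)%N -> fmodular Phi (section L phi) mu <= b) ->
  (modular Phi phi mu <= b%:E)%E.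
Proof.
move=> P0 mu0 H; apply: ge_ereal_sup => _ [X [finX _] <-].
have [L1 XL] := finite_sub_window finX.
pose L := maxn L0 L1.
have XL' : X `<=` window L.
  by apply: subset_trans XL _; apply: sub_window; exact: leq_maxr.
apply: (@le_trans _ _ (fmodular Phi (section L phi) mu)%:E); last first.
  by rewrite lee_fin H // leq_maxl.
rewrite -fmodular_section //; apply: lee_fsum_nneg_subset => //.
- exact: window_finite.
- exact/subsetP.
- by move=> t _; rewrite lee_fin; exact: (modular_term_ge0 phi _ P0 mu0).
Qed.

Lemma modular_supported Phi phi mu L : maps_halfline Phi -> Phi 0 = 0 -> 0 < mu ->
  (forall k, ~ window L k -> phi k = 0) ->
  modular Phi phi mu = (fmodular Phi (section L phi) mu)%:E.
Proof.
move=> P0 P00 mu0 sup; rewrite -fmodular_section // -esum_fset; first last.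
- by move=> i _; rewrite lee_fin; exact: (modular_term_ge0 phi _ P0 mu0).
- exact: window_finite.
rewrite esum_mkcond; apply: eq_esum => k _.
by case: ifPn => // /negP; rewrite inE => /sup ->; rewrite mul0r normc0 P00.
Qed.

Definition toeplitz L (c : int -> C) : 'M[C]_(window_size L) :=
  \matrix_(i, j) c (i%:Z - j%:Z).

Lemma toeplitz_persymmetric L c : persymmetric (toeplitz L c).
Proof.
move=> i j; rewrite !mxE; congr c; rewrite /=.
have := ltn_ord i; have := ltn_ord j; lia.
Qed.

(** The support condition cuts the convolution to the window, and the shifts by [L] cancel in the
    difference of indices. *)
Lemma section_dconv L (a : pdistribution R) phi :
  (forall k, ~ window L k -> phi k = 0) ->
  section L (dconv a phi) = toeplitz L (fourier_coef a) *m section L phi.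
Proof.
move=> sup; apply/matrixP => i j; rewrite ord1 !mxE /dconv.
rewrite -(@fsbig_widen _ _ _ _ (window L)) //; last first.
  by move=> k [_ /sup Lk] /=; rewrite Lk mulr0.
rewrite fsbig_window; apply: eq_bigr => k _; rewrite !mxE; congr (fourier_coef a _ * _).
by rewrite /window_int; lia.
Qed.

Lemma fmodular_le f g N (u : 'cV[C]_N) mu nu : halfline_iso f g ->
  0 < mu -> mu <= nu -> fmodular f u nu <= fmodular f u mu.
Proof.
move=> H mu0 mn; have nu0 : 0 < nu := lt_le_trans mu0 mn.
apply: ler_sum => i _.
rewrite (iso_le H) ?divr_ge0 ?normc_ge0 ?(ltW mu0) ?(ltW nu0) //.
by rewrite ler_wpM2l ?normc_ge0 // lef_pV2 ?posrE.
Qed.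

(** * Luxemburg norms and uniform bounds on the sections *)

Section Norm.
Variables f g : R -> R.
Hypothesis iso_fg : halfline_iso f g.
Hypothesis convex_f : convex_function halfline f.

Lemma orlicz_norm_le phi mu : 0 < mu -> (modular f phi mu <= 1)%E ->
  orlicz_norm f phi <= mu.
Proof.
by move=> mu0 Hm; apply: ge_inf => //; exists 0 => x [/ltW].
Qed.

(** By convexity, enlarging the scale by 1 + S divides a finite modular S by at least 1 + S. The set
    defining the norm is therefore nonempty. *)
Lemma orlicz_modular_le1 phi : orlicz f phi ->
  exists2 mu, 0 < mu & (modular f phi mu <= 1)%E.
Proof.
case=> mu mu0 fin.
have f0 := iso_ge0 iso_fg.
pose S := fine (modular f phi mu).
have mE : modular f phi mu = S%:E.
  rewrite fineK // ge0_fin_numE //.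
  by apply: esum_ge0 => k _; rewrite lee_fin; exact: (modular_term_ge0 phi _ f0 mu0).
have S0 : 0 <= S.
  rewrite -lee_fin -mE; apply: esum_ge0 => k _; rewrite lee_fin; exact: (modular_term_ge0 phi _ f0 mu0).
have n0 : 0 < 1 + S by rewrite ltr_pwDl.
exists ((1 + S) * mu); first by rewrite mulr_gt0.
apply: (@modular_le _ _ _ 0%N) => //; first by rewrite mulr_gt0.
move=> L _; apply: (@le_trans _ _ ((1 + S)^-1 * S)); last first.
  by rewrite mulrC ler_pdivrMr // mul1r lerDr.
apply: (@le_trans _ _ ((1 + S)^-1 * fmodular f (section L phi) mu)); last first.
  rewrite ler_wpM2l ?invr_ge0 ?(ltW n0) // -lee_fin -mE.
  exact: fmodular_section_le.
rewrite /fmodular mulr_sumr; apply: ler_sum => i _.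
rewrite [X in f X](_ : _ = (1 + S)^-1 * (normc (section L phi i ord0) / mu)); last first.
  by field; rewrite !gt_eqF.
apply: convex_scale_le => //; first exact: iso0 iso_fg.
  by rewrite invr_ge0 (ltW n0) /= invf_le1 // lerDl.
by rewrite divr_ge0 ?normc_ge0 // ltW.
Qed.

(** The strict inequality provides an admissible scale below [mu], so attainment of the infimum is
    not at issue. *)
Lemma modular_le1_of_norm_lt phi mu : orlicz f phi -> orlicz_norm f phi < mu ->
  (modular f phi mu <= 1)%E.
Proof.
move=> /orlicz_modular_le1 [nu nu0 Hnu] lt.
have [|nu' [nu'0 Hnu'] nm] := inf_lt _ lt; first by exists nu.
have mu0 : 0 < mu := lt_trans nu'0 nm.
apply: (@modular_le _ _ _ 0%N) => //; first exact: iso_ge0 iso_fg.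
move=> L _; apply: le_trans (fmodular_le _ iso_fg nu'0 (ltW nm)) _.
rewrite -lee_fin; apply: le_trans Hnu'; apply: fmodular_section_le => //.
exact: iso_ge0 iso_fg.
Qed.

Lemma finitely_supported_window phi : finitely_supported phi ->
  exists L, forall k, ~ window L k -> phi k = 0.
Proof.
move=> /finite_sub_window [L HL]; exists L => k kL.
by apply/eqP/negPn/negP => pk; apply: kL; exact: HL.
Qed.

Lemma finitely_supported_modular phi : finitely_supported phi ->
  exists2 mu, 0 < mu & (modular f phi mu <= 1)%E.
Proof.
move=> /finitely_supported_window [L HL].
have [mu mu0 Hmu] := fmodular_le1_exists (section L phi) iso_fg.
exists mu => //; rewrite (modular_supported _ _ _ HL) ?lee_fin //.
  exact: iso_ge0 iso_fg.
exact: iso0 iso_fg.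
Qed.

(** A nonzero entry bounds every admissible scale from below. The quotients in the multiplier norm
    are thus genuine. *)
Lemma orlicz_norm_gt0 phi : finitely_supported phi -> phi <> (fun=> 0) ->
  0 < orlicz_norm f phi.
Proof.
move=> fs nz; have [mu mu0 Hmu] := finitely_supported_modular fs.
have [k pk] : exists k, phi k != 0.
  apply: contrapT => H; apply: nz; apply/funext => k.
  by apply/eqP/negPn/negP => pk; apply: H; exists k.
have g1 : 0 < g 1 by apply: (iso_gt0 (halfline_iso_sym iso_fg)).
have np : 0 < normc (phi k).
  by rewrite lt_neqAle normc_ge0 andbT eq_sym; apply: contra pk => /eqP/eq0_normc ->.
apply: (@lt_le_trans _ _ (normc (phi k) / g 1)); first by rewrite divr_gt0.
apply: lb_le_inf; first by exists mu.
move=> nu [nu0 Hnu]; rewrite ler_pdivrMr // mulrC.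
have [L HL] := finite_sub_window (finite_set1 k).
have kL := HL k erefl.
have [_ _ /(_ k kL) [i iL ik]] := window_int_bij L.
rewrite -ik; have -> : phi (window_int L i) = section L phi (Ordinal iL) ord0 by rewrite mxE.
apply: (fmodular_entry_le _ iso_fg nu0); rewrite -lee_fin; apply: le_trans Hnu.
by apply: fmodular_section_le => //; exact: iso_ge0 iso_fg.
Qed.

(** A vector is extended by zero, convolved with the coefficients of [a], and restricted to the
    window again. *)
Lemma multiplier_toeplitz_bounded (a : pdistribution R) : multipliers f a ->
  exists2 c, 0 < c & forall L, modular_bounded f c (toeplitz L (fourier_coef a)).
Proof.
move=> [orl fin].
have [c0 c00 Hc] : exists2 c, 0 < c & forall phi, finitely_supported phi -> phi <> (fun=> 0) ->
    orlicz_norm f (dconv a phi) <= c * orlicz_norm f phi.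
  have ub phi : finitely_supported phi -> phi <> (fun=> 0) ->
      ((orlicz_norm f (dconv a phi) / orlicz_norm f phi)%:E <= multiplier_norm f a)%E.
    by move=> fs nz; apply: ereal_sup_ubound; exists phi.
  exists (1 + `|fine (multiplier_norm f a)|); first by rewrite ltr_pwDl.
  move=> phi fs nz; have p0 := orlicz_norm_gt0 fs nz.
  have := ub phi fs nz; move: fin; case: (multiplier_norm f a) => [r| |] //= _.
  rewrite lee_fin ler_pdivrMr // => /le_trans; apply.
  rewrite ler_pM2r //; have := ler_norm r; lra.
(* Doubling creates the strict inequality that [modular_le1_of_norm_lt] requires. *)
exists (2 * c0); first by rewrite mulr_gt0.
move=> L u mu mu0 Hu.
pose phi := extension u.
have sup k : ~ window L k -> phi k = 0 by exact: extension_support.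
have fs : finitely_supported phi.
  apply: sub_finite_set (window_finite L) => k /= pk.
  by apply: contrapT => /sup E; move: pk; rewrite E eqxx.
have f0 := iso_ge0 iso_fg.
have nu0 : 0 < 2 * c0 * mu by rewrite !mulr_gt0.
have -> : toeplitz L (fourier_coef a) *m u = section L (dconv a phi).
  by rewrite section_dconv // section_extension.
(* The zero sequence is excluded from the supremum and is treated apart. *)
have [pz|nz] := pselect (phi = fun=> 0).
  have -> : section L (dconv a phi) = 0.
    rewrite section_dconv // pz; have -> : section L (fun=> 0) = 0.
      by apply/matrixP => i j; rewrite !mxE.
    exact: mulmx0.
  rewrite /fmodular big1 // => i _.
  by rewrite mxE normc0 mul0r (iso0 iso_fg).
rewrite -lee_fin; apply: le_trans (fmodular_section_le _ _ _ _) _ => //.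
apply: modular_le1_of_norm_lt; first exact: orl.
apply: le_lt_trans (Hc phi fs nz) _.
have : orlicz_norm f phi <= mu.
  apply: orlicz_norm_le => //.
  by rewrite (modular_supported f0 (iso0 iso_fg) mu0 sup) section_extension lee_fin.
rewrite -(ler_pM2l c00) => /le_lt_trans; apply.
by have := mulr_gt0 c00 mu0; lra.
Qed.

(** A bound uniform in [L] passes to the whole sequence by [modular_le], starting from a window that
    contains the support of [phi]. *)
Lemma toeplitz_bounded_multiplier (a : pdistribution R) c : 0 < c ->
  (forall L, modular_bounded f c (toeplitz L (fourier_coef a))) -> multipliers f a.
Proof.
move=> c0 bnd.
have f0 := iso_ge0 iso_fg.
have key phi mu : finitely_supported phi -> 0 < mu -> (modular f phi mu <= 1)%E ->
    (modular f (dconv a phi) (c * mu) <= 1)%E.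
  move=> /finitely_supported_window [L0 HL0] mu0 Hm.
  apply: (@modular_le _ _ _ L0) => //; first by rewrite mulr_gt0.
  move=> L L0L.
  have HL k : ~ window L k -> phi k = 0.
    by move=> kL; apply: HL0 => /(sub_window L0L).
  rewrite section_dconv //; apply: bnd => //.
  by rewrite -lee_fin; apply: le_trans Hm; exact: fmodular_section_le.
split.
  move=> phi fs; have [mu mu0 Hmu] := finitely_supported_modular fs.
  exists (c * mu); first by rewrite mulr_gt0.
  exact: le_lt_trans (key _ _ fs mu0 Hmu) (ltry _).
apply: (@le_lt_trans _ _ c%:E); last exact: ltry.
apply: ge_ereal_sup => _ [phi [fs nz] <-].
have p0 := orlicz_norm_gt0 fs nz.
rewrite lee_fin ler_pdivrMr // mulrC -ler_pdivrMr //.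
apply: lb_le_inf; first by have [mu mu0 Hmu] := finitely_supported_modular fs; exists mu.
move=> mu [mu0 Hmu]; rewrite ler_pdivrMr // mulrC.
by apply: orlicz_norm_le; [rewrite mulr_gt0 | exact: key].
Qed.

End Norm.

End FiniteSections.

Theorem lemma4p6 (R : realType) (Phi : R -> R) (theta : R)
    (hPhi : is_Nfunction Phi)
    (halpha : (1 < MO_lower Phi)%E)
    (halphabeta : (MO_lower Phi <= MO_upper Phi)%E)
    (hbeta : (MO_upper Phi < +oo)%E)
    (htheta0 : 0 < theta)
    (htheta : theta < 2 * Num.min (fine (MO_upper Phi))^-1
                                  (1 - (fine (MO_lower Phi))^-1)) :
  multipliers (Phi_theta Phi theta) `<=` multipliers Phi.
Proof.
move=> a Ma.
have theta01 : 0 < theta < 1.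
  by rewrite htheta0 (theta_lt1 halpha halphabeta hbeta htheta).
have [K K0 [g0 [iso0 cvx0 lo up]]] :=
  Phi_theta_interpolation hPhi halpha halphabeta hbeta htheta0 htheta.
have isoPhi := Nfun_iso hPhi.
have cvx := Nfun_convex hPhi.
have [c c0 bnd] := multiplier_toeplitz_bounded iso0 cvx0 Ma.
apply: (toeplitz_bounded_multiplier isoPhi _ (c := interpolation_constant theta K c)).
  exact: interpolation_constant_gt0.
(* The same [c] bounds every section on l^2 too, so the interpolated constant does not depend on
   [L]. *)
move=> L; apply: (interpolation iso0 isoPhi) => // u.
exact: persymmetric_l2_bound iso0 c0 (toeplitz_persymmetric _) (bnd L).
Qed.
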